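(* Let $k$ be a field of characteristic zero and $\lambda\in k$, $\lambda\neq0$. There is a nondegenerate dual pairing of the Hopf algebras $k_\lambda[\mathrm{Heis}]$ and $U_\lambda(\mathbf{heis})$ given by $$\langle t^iX^jY^l,\ z^p\alpha^q\beta^r\rangle=j!\,(\lambda q)^l\,\delta_{i,p}\,\delta_{j,r}$$ for all $i,j,l,p,r\in\mathbb{N}$ and $q\in\mathbb{Z}$ (with $0^0=1$).
   Context: A dual pairing of Hopf algebras $\mathcal{H},\mathcal{K}$ is a bilinear form with $\langle a,xy\rangle=\sum\langle a_{(1)},x\rangle\langle a_{(2)},y\rangle$, $\langle ab,x\rangle=\sum\langle a,x_{(1)}\rangle\langle b,x_{(2)}\rangle$, $\langle Sa,x\rangle=\langle a,Sx\rangle$, $\langle a,1\rangle=\varepsilon(a)$, $\langle1,x\rangle=\varepsilon(x)$; nondegenerate means no nonzero element of either side pairs to zero with everything on the other side. $k_\lambda[\mathrm{Heis}]$ is the Hopf algebra generated by $X,Y,t$ with $[Y,X]=\lambda X$, $[X,t]=\frac12\lambda t^2$, $[Y,t]=\lambda t$, $\Delta(X)=X\otimes1+1\otimes X+Y\otimes t$, $Y,t$ primitive, $\varepsilon(X)=\varepsilon(Y)=\varepsilon(t)=0$, $S(Y)=-Y$, $S(t)=-t$, $S(X)=-X+Yt$. $U_\lambda(\mathbf{heis})$ is the Hopf algebra generated by $z,\alpha^{\pm1},\beta$ with $[\alpha,\beta]=0$, $[z,\alpha]=-2\lambda\alpha\beta$, $[z,\beta]=\lambda\beta^2$, $\Delta(\alpha)=\alpha\otimes\alpha$,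 $\Delta(\beta)=\beta\otimes1+\alpha\otimes\beta$, $\Delta(z)=z\otimes1+\alpha\otimes z$, with counit ($\varepsilon(\alpha)=1$, $\varepsilon(\beta)=\varepsilon(z)=0$) and antipode determined accordingly.
   Formalization: The printed claim fails (t primitive forces ⟨t²,z²⟩=2; the printed relations force β=0). Proved instead with [z,α]=-λαβ, [z,β]=-(λ/2)β² in U_λ(heis), and with the pairing formula i! j! (λq)^l δ_{i,p} δ_{j,r}. *)

(* Defs.v *)
From HB Require Import structures.
From mathcomp Require Import all_boot all_algebra.
From mathcomp Require Import boolp classical_sets.

Set Implicit Arguments.
Unset Strict Implicit.
Unset Printing Implicit Defensive.

Import GRing.Theory.
Local Open Scope ring_scope.
Local Open Scope quotient_scope.

Inductive pterm (k G : Type) : Type :=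
| PConst of k
| PGen of G
| PAdd of pterm k G & pterm k G
| PMul of pterm k G & pterm k G.
Arguments PConst {k G} c.
Arguments PGen {k G} g.

Declare Scope pterm_scope.
Delimit Scope pterm_scope with pt.
Bind Scope pterm_scope with pterm.
Notation "c %:PT" := (PConst c) (at level 2, format "c %:PT") : pterm_scope.
Notation "s + t" := (PAdd s t) : pterm_scope.
Notation "s * t" := (PMul s t) : pterm_scope.
Notation "- s" := (PMul (PConst (-1)) s) : pterm_scope.
Notation "s - t" := (PAdd s (- t)%pt) : pterm_scope.

HB.instance Definition _ (k G : Type) := gen_eqMixin (pterm k G).
HB.instance Definition _ (k G : Type) := gen_choiceMixin (pterm k G).

(* The least congruence that contains the relations and makes the terms an
   associative unital [k]-algebra: the free algebra on [G] modulo the two-sided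
   ideal generated by the differences of the two sides of the relations.      *)
Inductive pcong (k : fieldType) (G : Type)
    (rel : pterm k G -> pterm k G -> Prop) : pterm k G -> pterm k G -> Prop :=
| pcong_rel s t : rel s t -> pcong rel s t
| pcong_refl s : pcong rel s s
| pcong_sym s t : pcong rel s t -> pcong rel t s
| pcong_trans t s u : pcong rel s t -> pcong rel t u -> pcong rel s u
| pcong_add s s' t t' :
    pcong rel s s' -> pcong rel t t' -> pcong rel (s + t)%pt (s' + t')%pt
| pcong_mul s s' t t' :
    pcong rel s s' -> pcong rel t t' -> pcong rel (s * t)%pt (s' * t')%pt
| pcong_addA s t u : pcong rel (s + (t + u))%pt (s + t + u)%pt
| pcong_addC s t : pcong rel (s + t)%pt (t + s)%pt
| pcong_add0 s : pcong rel (0%:PT + s)%pt s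
| pcong_addN s : pcong rel (- s + s)%pt 0%:PT%pt
| pcong_mulA s t u : pcong rel (s * (t * u))%pt (s * t * u)%pt
| pcong_mul1l s : pcong rel (1%:PT * s)%pt s
| pcong_mul1r s : pcong rel (s * 1%:PT)%pt s
| pcong_mulDl s t u : pcong rel ((s + t) * u)%pt (s * u + t * u)%pt
| pcong_mulDr s t u : pcong rel (s * (t + u))%pt (s * t + s * u)%pt
| pcong_constD c d : pcong rel (c + d)%R%:PT%pt (c%:PT + d%:PT)%pt
| pcong_constM c d : pcong rel (c * d)%R%:PT%pt (c%:PT * d%:PT)%pt
| pcong_constC c s : pcong rel (c%:PT * s)%pt (s * c%:PT)%pt.

(* MathComp algebras are nonzero, hence the last field. *)
Record presentation (k : fieldType) := Presentation {
  pgens : Type;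
  prel : pterm k pgens -> pterm k pgens -> Prop;
  pproper : ~ pcong prel 1%:PT%pt 0%:PT%pt
}.

Section Presented.
Variables (k : fieldType) (P : presentation k).
Local Notation term := (pterm k (pgens P)).
Local Notation cong := (pcong (@prel k P)).

Let pcongb (s t : term) : bool := `[< cong s t >].

Let pcongb_refl : reflexive pcongb.
Proof. by move=> s; apply/asboolP; exact: pcong_refl. Qed.

Let pcongb_sym : symmetric pcongb.
Proof. by move=> s t; apply/asboolP/asboolP; exact: pcong_sym. Qed.

Let pcongb_trans : transitive pcongb.
Proof.
by move=> t s u /asboolP st /asboolP tu; apply/asboolP; exact: pcong_trans tu.
Qed.

Definition pcong_equiv := EquivRel pcongb pcongb_refl pcongb_sym pcongb_trans.

Definition presented := {eq_quot pcong_equiv}.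
HB.instance Definition _ := Choice.on presented.
HB.instance Definition _ := EqQuotient.on presented.

Definition pclass (s : term) : presented := \pi_presented s.

Lemma pclassE s t : (pclass s = pclass t) <-> cong s t.
Proof.
split=> [/eqmodP/asboolP //|st]; exact/eqmodP/asboolP.
Qed.

Lemma pclassK (x : presented) : pclass (repr x) = x.
Proof. exact: reprK. Qed.

Lemma reprP s : cong (repr (pclass s)) s.
Proof. by apply/pclassE; rewrite pclassK. Qed.

Let zero := pclass 0%:PT.
Let one := pclass 1%:PT.
Let add (x y : presented) := pclass (repr x + repr y)%pt.
Let opp (x : presented) := pclass (- repr x)%pt.
Let mul (x y : presented) := pclass (repr x * repr y)%pt.
Let scale c (x : presented) := pclass (c%:PT * repr x)%pt.

Let addE s t : add (pclass s) (pclass t) = pclass (s + t)%pt.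
Proof. by apply/pclassE/pcong_add; exact: reprP. Qed.
Let mulE s t : mul (pclass s) (pclass t) = pclass (s * t)%pt.
Proof. by apply/pclassE/pcong_mul; exact: reprP. Qed.
Let oppE s : opp (pclass s) = pclass (- s)%pt.
Proof. apply/pclassE/pcong_mul; [exact: pcong_refl|exact: reprP]. Qed.
Let scaleE c s : scale c (pclass s) = pclass (c%:PT * s)%pt.
Proof. apply/pclassE/pcong_mul; [exact: pcong_refl|exact: reprP]. Qed.

Let addA : associative add.
Proof.
move=> x y z; rewrite -[x]pclassK -[y]pclassK -[z]pclassK !addE.
exact/pclassE/pcong_addA.
Qed.
Let addC : commutative add.
Proof.
by move=> x y; rewrite -[x]pclassK -[y]pclassK !addE; exact/pclassE/pcong_addC.
Qed.
Let add0 : left_id zero add.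
Proof. by move=> x; rewrite -[x]pclassK addE; exact/pclassE/pcong_add0. Qed.
Let addN : left_inverse zero opp add.
Proof. by move=> x; rewrite -[x]pclassK oppE addE; exact/pclassE/pcong_addN. Qed.

HB.instance Definition _ := GRing.isZmodule.Build presented addA addC add0 addN.

Lemma pclassD s t : pclass (s + t)%pt = pclass s + pclass t.
Proof. exact/esym/addE. Qed.

Let mulA : associative mul.
Proof.
move=> x y z; rewrite -[x]pclassK -[y]pclassK -[z]pclassK !mulE.
exact/pclassE/pcong_mulA.
Qed.
Let mulOl : left_id one mul.
Proof. by move=> x; rewrite -[x]pclassK mulE; exact/pclassE/pcong_mul1l. Qed.
Let mulOr : right_id one mul.
Proof. by move=> x; rewrite -[x]pclassK mulE; exact/pclassE/pcong_mul1r. Qed.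
Let mulDl : left_distributive mul +%R.
Proof.
move=> x y z; rewrite -[x]pclassK -[y]pclassK -[z]pclassK.
rewrite -pclassD !mulE -pclassD; exact/pclassE/pcong_mulDl.
Qed.
Let mulDr : right_distributive mul +%R.
Proof.
move=> x y z; rewrite -[x]pclassK -[y]pclassK -[z]pclassK.
rewrite -pclassD !mulE -pclassD; exact/pclassE/pcong_mulDr.
Qed.
Let one_neq0 : one != 0.
Proof. by apply/eqP => /pclassE; exact: pproper. Qed.

HB.instance Definition _ := GRing.Zmodule_isNzRing.Build presented
  mulA mulOl mulOr mulDl mulDr one_neq0.

Lemma pclassM s t : pclass (s * t)%pt = pclass s * pclass t.
Proof. exact/esym/mulE. Qed.

Let scaleM c x : scale c x = pclass c%:PT * x.
Proof. by rewrite -[x]pclassK scaleE pclassM. Qed.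

Let scaleA a b x : scale a (scale b x) = scale (a * b) x.
Proof.
rewrite !scaleM mulrA; congr (_ * _); rewrite -pclassM.
exact/pclassE/pcong_sym/pcong_constM.
Qed.
Let scale1 : left_id 1 scale.
Proof. by move=> x; rewrite scaleM mul1r. Qed.
Let scaleDr : right_distributive scale +%R.
Proof. by move=> c x y; rewrite !scaleM mulrDr. Qed.
Let scaleDl x : {morph scale^~ x : a b / a + b}.
Proof.
move=> a b; rewrite !scaleM -mulrDl; congr (_ * _).
rewrite -pclassD; exact/pclassE/pcong_constD.
Qed.

HB.instance Definition _ := GRing.Zmodule_isLmodule.Build k presented
  scaleA scale1 scaleDr scaleDl.

Let scaleAl (a : k) (x y : presented) : a *: (x * y) = (a *: x) * y.
Proof. by rewrite /GRing.scale /= !scaleM mulrA. Qed.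

HB.instance Definition _ := GRing.Lmodule_isLalgebra.Build k presented scaleAl.

Let scaleAr (a : k) (x y : presented) : a *: (x * y) = x * (a *: y).
Proof.
rewrite /GRing.scale /= !scaleM !mulrA; congr (_ * _).
rewrite -[x]pclassK -!pclassM; exact/pclassE/pcong_constC.
Qed.

HB.instance Definition _ := GRing.Lalgebra_isAlgebra.Build k presented scaleAr.

Definition pgen (g : pgens P) : presented := pclass (PGen g).

Lemma pclassC c : pclass c%:PT = c%:A.
Proof. by rewrite /GRing.scale /= scaleM mulr1. Qed.

End Presented.
Arguments pgen {k} P g.

Section Evaluation.
Variables (k : fieldType) (B : algType k).

Fixpoint peval (G : Type) (f : G -> B) (s : pterm k G) : B :=
  match s with
  | PConst c => c%:A
  | PGen g => f g
  | PAdd s t => peval f s + peval f t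
  | PMul s t => peval f s * peval f t
  end.

Lemma peval_cong G (rel : pterm k G -> pterm k G -> Prop) (f : G -> B) :
  (forall s t, rel s t -> peval f s = peval f t) ->
  forall s t, pcong rel s t -> peval f s = peval f t.
Proof.
move=> frel s t; elim=> {s t} /=.
- exact: frel.
- by [].
- by [].
- by move=> t s u _ -> _ ->.
- by move=> s s' t t' _ -> _ ->.
- by move=> s s' t t' _ -> _ ->.
- by move=> s t u; rewrite addrA.
- by move=> s t; rewrite addrC.
- by move=> s; rewrite scale0r add0r.
- by move=> s; rewrite scaleN1r mulN1r addNr scale0r.
- by move=> s t u; rewrite mulrA.
- by move=> s; rewrite scale1r mul1r.
- by move=> s; rewrite scale1r mulr1.
- by move=> s t u; rewrite mulrDl.
- by move=> s t u; rewrite mulrDr.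
- by move=> c d; rewrite scalerDl.
- by move=> c d; rewrite -scalerAl mul1r scalerA.
- by move=> c s; rewrite -scalerAl -scalerAr mul1r mulr1.
Qed.

End Evaluation.

Lemma proper_of_model (k : fieldType) (B : algType k) G
    (rel : pterm k G -> pterm k G -> Prop) (f : G -> B) :
  (forall s t, rel s t -> peval f s = peval f t) ->
  ~ pcong rel 1%:PT%pt 0%:PT%pt.
Proof.
move=> frel /(peval_cong frel) /= /eqP.
by rewrite scale1r scale0r oner_eq0.
Qed.

Section Universal.
Variables (k : fieldType) (P : presentation k).

Lemma peval_pgen s : peval (pgen P) s = pclass s.
Proof.
elim: s => [c|g|s IHs t IHt|s IHs t IHt] /=.
- by rewrite pclassC.
- by [].
- by rewrite IHs IHt pclassD.
- by rewrite IHs IHt pclassM.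
Qed.

Lemma pgen_rel s t : prel s t -> peval (pgen P) s = peval (pgen P) t.
Proof. by move=> st; rewrite !peval_pgen; exact/pclassE/pcong_rel. Qed.

Lemma presented_ind (Q : presented P -> Prop) :
  (forall c : k, Q c%:A) -> (forall g, Q (pgen P g)) ->
  (forall x y, Q x -> Q y -> Q (x + y)) ->
  (forall x y, Q x -> Q y -> Q (x * y)) -> forall x, Q x.
Proof.
move=> QC Qg QD QM x; rewrite -[x]pclassK.
elim: (repr x) => [c|g|s IHs t IHt|s IHs t IHt].
- by rewrite pclassC.
- exact: Qg.
- by rewrite pclassD; exact: QD.
- by rewrite pclassM; exact: QM.
Qed.

Section Lift.
Variables (B : algType k) (f : pgens P -> B).
Hypothesis frel : forall s t, prel s t -> peval f s = peval f t.

Definition plift_fun of (forall s t, prel s t -> peval f s = peval f t) :=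
  fun x : presented P => peval f (repr x).
Local Notation lift := (plift_fun frel).

Let liftE s : lift (pclass s) = peval f s.
Proof. by apply: (peval_cong frel); exact: reprP. Qed.

Let lift_additive : zmod_morphism lift.
Proof.
move=> x y; rewrite -[x]pclassK -[y]pclassK.
have -> : pclass (repr x) - pclass (repr y) =
  pclass (repr x - repr y)%pt :> presented P.
  by rewrite pclassD pclassM pclassC scaleN1r mulN1r.
by rewrite !liftE /= scaleN1r mulN1r.
Qed.

Let lift_mult : monoid_morphism lift.
Proof.
split=> [|x y].
  have -> : 1 = pclass 1%:PT :> presented P by rewrite pclassC scale1r.
  by rewrite liftE /= scale1r.
by rewrite -[x]pclassK -[y]pclassK -pclassM !liftE.
Qed.

Let lift_scale : scalable lift.
Proof.
move=> c x; rewrite -[x]pclassK.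
have -> : c *: pclass (repr x) = pclass (c%:PT * repr x)%pt :> presented P.
  by rewrite pclassM pclassC -scalerAl mul1r.
by rewrite !liftE /= -scalerAl mul1r.
Qed.

HB.instance Definition _ :=
  GRing.isZmodMorphism.Build (presented P) B lift lift_additive.
HB.instance Definition _ :=
  GRing.isMonoidMorphism.Build (presented P) B lift lift_mult.
HB.instance Definition _ :=
  GRing.isScalable.Build k (presented P) B *:%R lift lift_scale.

Definition plift : {lrmorphism presented P -> B} := lift.

Lemma plift_gen g : plift (pgen P g) = f g.
Proof. exact: liftE. Qed.

End Lift.
End Universal.

Definition balanced (k : fieldType) (A B : lmodType k) (V : nmodType)
    (f : A -> B -> V) : Prop :=
  [/\ forall b, {morph f^~ b : a a' / a + a'},
      forall a, {morph f a : b b' / b + b'} &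
      forall c a b, f (c *: a) b = f a (c *: b)].

Section Tensor.
Variables (k : fieldType) (A B : lmodType k).

(* The list [:: (a1, b1); ...; (an, bn)] stands for the formal sum of the
   symbols a1 (x) b1, ..., an (x) bn.                                         *)
Inductive teq : seq (A * B) -> seq (A * B) -> Prop :=
| teq_refl s : teq s s
| teq_sym s t : teq s t -> teq t s
| teq_trans t s u : teq s t -> teq t u -> teq s u
| teq_cat s s' t t' : teq s s' -> teq t t' -> teq (s ++ t) (s' ++ t')
| teq_comm s t : teq (s ++ t) (t ++ s)
| teq_zero : teq [:: (0, 0)] [::]
| teq_addl a a' b : teq [:: (a + a', b)] [:: (a, b); (a', b)]
| teq_addr a b b' : teq [:: (a, b + b')] [:: (a, b); (a, b')]
| teq_scale c a b : teq [:: (c *: a, b)] [:: (a, c *: b)].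

Let teqb s t : bool := `[< teq s t >].
Let teqb_refl : reflexive teqb.
Proof. by move=> s; apply/asboolP; exact: teq_refl. Qed.
Let teqb_sym : symmetric teqb.
Proof. by move=> s t; apply/asboolP/asboolP; exact: teq_sym. Qed.
Let teqb_trans : transitive teqb.
Proof.
by move=> t s u /asboolP st /asboolP tu; apply/asboolP; exact: teq_trans tu.
Qed.

Definition teq_equiv := EquivRel teqb teqb_refl teqb_sym teqb_trans.

Definition tensor := {eq_quot teq_equiv}.
HB.instance Definition _ := Choice.on tensor.
HB.instance Definition _ := EqQuotient.on tensor.

Definition tclass (s : seq (A * B)) : tensor := \pi_tensor s.

Lemma tclassE s t : tclass s = tclass t <-> teq s t.
Proof. by split=> [/eqmodP/asboolP //|st]; exact/eqmodP/asboolP. Qed.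

Lemma tclassK (u : tensor) : tclass (repr u) = u.
Proof. exact: reprK. Qed.

Let trepr s : teq (repr (tclass s)) s.
Proof. by apply/tclassE; rewrite tclassK. Qed.

Definition tpure (a : A) (b : B) : tensor := tclass [:: (a, b)].

(* The value at [u = \sum_i a_i (x) b_i] of the map induced by [f], i.e.
   [\sum_i f a_i b_i]; it does not depend on the decomposition when [f] is
   balanced (lemma [tliftE]).                                                 *)
Definition tlift (V : nmodType) (f : A -> B -> V) (u : tensor) : V :=
  \sum_(p <- repr u) f p.1 p.2.

Lemma tlift_class (V : zmodType) (f : A -> B -> V) : balanced f ->
  forall s, tlift f (tclass s) = \sum_(p <- s) f p.1 p.2.
Proof.
move=> [fl fr fs] s; rewrite /tlift; move: (repr _) (trepr s) => r.
elim=> {s r} //.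
- by move=> s t u _ -> _ ->.
- by move=> s s' t t' _ IHs _ IHt; rewrite !big_cat /= IHs IHt.
- by move=> s t; rewrite !big_cat /= addrC.
- rewrite big_seq1 big_nil /=; apply: (addrI (f 0 0)).
  by rewrite -fl !addr0.
- by move=> a a' b; rewrite big_seq1 big_cons big_seq1 /= fl.
- by move=> a b b'; rewrite big_seq1 big_cons big_seq1 /= fr.
- by move=> c a b; rewrite !big_seq1 /= fs.
Qed.

Let add (u v : tensor) := tclass (repr u ++ repr v).
Let negs (s : seq (A * B)) := [seq (- p.1, p.2) | p <- s].
Let scales c (s : seq (A * B)) := [seq (c *: p.1, p.2) | p <- s].

Let scales_teq c s t : teq s t -> teq (scales c s) (scales c t).
Proof.
elim=> {s t} /=.
- by move=> s; exact: teq_refl.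
- by move=> s t _; exact: teq_sym.
- by move=> t s u _ + _; exact: teq_trans.
- by move=> s s' t t' _ IHs _ IHt; rewrite /scales !map_cat; exact: teq_cat.
- by move=> s t; rewrite /scales !map_cat; exact: teq_comm.
- by rewrite scaler0; exact: teq_zero.
- by move=> a a' b; rewrite scalerDr; exact: teq_addl.
- by move=> a b b'; exact: teq_addr.
- by move=> d a b; rewrite scalerA mulrC -scalerA; exact: teq_scale.
Qed.

Let negsE s : negs s = scales (-1) s.
Proof. by apply: eq_map => p; rewrite scaleN1r. Qed.

Let opp (u : tensor) := tclass (negs (repr u)).
Let scale c (u : tensor) := tclass (scales c (repr u)).

Let addE s t : add (tclass s) (tclass t) = tclass (s ++ t).
Proof. by apply/tclassE/teq_cat; exact: trepr. Qed.
Let oppE s : opp (tclass s) = tclass (negs s).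
Proof. by apply/tclassE; rewrite !negsE; exact/scales_teq/trepr. Qed.
Let scaleE c s : scale c (tclass s) = tclass (scales c s).
Proof. exact/tclassE/scales_teq/trepr. Qed.

Let addA : associative add.
Proof.
move=> x y z; rewrite -[x]tclassK -[y]tclassK -[z]tclassK !addE.
by rewrite catA.
Qed.
Let addC : commutative add.
Proof.
by move=> x y; rewrite -[x]tclassK -[y]tclassK !addE; exact/tclassE/teq_comm.
Qed.
Let add0 : left_id (tclass [::]) add.
Proof. by move=> x; rewrite -[x]tclassK addE. Qed.

Let teq_0l b : teq [:: (0, b)] [::].
Proof.
apply: teq_trans teq_zero; rewrite -[X in (X, b)](scale0r 0).
by apply: teq_trans (teq_scale _ _ _) _; rewrite scale0r; exact: teq_refl.
Qed.

Let addN : left_inverse (tclass [::]) opp add.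
Proof.
move=> x; rewrite -[x]tclassK oppE addE; apply/tclassE.
elim: (repr x) => [|[a b] s IHs] /=; first exact: teq_refl.
have h1 : teq ((- a, b) :: negs s ++ (a, b) :: s)
              ([:: (- a, b)] ++ ([:: (a, b)] ++ (negs s ++ s))).
  rewrite -cat1s; apply: teq_cat; first exact: teq_refl.
  rewrite -cat1s !catA; apply: teq_cat; last exact: teq_refl.
  exact: teq_comm.
apply: teq_trans h1 _; rewrite catA -[X in teq _ X](cat0s [::]).
apply: teq_cat => //; apply: teq_trans (teq_sym (teq_addl _ _ _)) _.
by rewrite addNr.
Qed.

HB.instance Definition _ := GRing.isZmodule.Build tensor addA addC add0 addN.

Lemma tclass_cat s t : tclass (s ++ t) = tclass s + tclass t.
Proof. exact/esym/addE. Qed.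

Lemma tclass_sum s : tclass s = \sum_(p <- s) tpure p.1 p.2.
Proof.
elim: s => [|[a b] s IHs]; first by rewrite big_nil.
by rewrite big_cons -IHs -tclass_cat.
Qed.

Let scaleA a b x : scale a (scale b x) = scale (a * b) x.
Proof.
rewrite -[x]tclassK !scaleE; congr tclass; rewrite /scales -map_comp.
by apply: eq_map => p /=; rewrite scalerA.
Qed.
Let scale1 : left_id 1 scale.
Proof.
move=> x; rewrite -[x]tclassK scaleE; congr tclass.
by rewrite -[RHS]map_id; apply: eq_map => -[a b] /=; rewrite scale1r.
Qed.
Let scaleDr : right_distributive scale +%R.
Proof.
move=> c x y; rewrite -[x]tclassK -[y]tclassK -tclass_cat !scaleE -tclass_cat.
by rewrite /scales map_cat.
Qed.
Let scaleDl x : {morph scale^~ x : a b / a + b}.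
Proof.
move=> a b; rewrite -[x]tclassK !scaleE !tclass_sum !big_map -big_split /=.
apply: eq_bigr => p _; rewrite -tclass_cat; apply/tclassE; rewrite scalerDl.
exact: teq_addl.
Qed.

HB.instance Definition _ := GRing.Zmodule_isLmodule.Build k tensor
  scaleA scale1 scaleDr scaleDl.

Lemma tpureDl a a' b : tpure (a + a') b = tpure a b + tpure a' b.
Proof. by rewrite -tclass_cat; exact/tclassE/teq_addl. Qed.
Lemma tpureDr a b b' : tpure a (b + b') = tpure a b + tpure a b'.
Proof. by rewrite -tclass_cat; exact/tclassE/teq_addr. Qed.
Lemma tpureZl c a b : tpure (c *: a) b = c *: tpure a b.
Proof. exact/esym/scaleE. Qed.
Lemma tpureZr c a b : tpure a (c *: b) = c *: tpure a b.
Proof. by rewrite -tpureZl; exact/tclassE/teq_sym/teq_scale. Qed.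

Lemma tpure_balanced : balanced tpure.
Proof.
split=> [b a a'|a b b'|c a b]; rewrite ?tpureDl ?tpureDr //.
by rewrite tpureZl tpureZr.
Qed.

Lemma tensor_sum (u : tensor) : u = \sum_(p <- repr u) tpure p.1 p.2.
Proof. by rewrite -tclass_sum tclassK. Qed.

Lemma tensor_ind (Q : tensor -> Prop) :
  Q 0 -> (forall a b, Q (tpure a b)) -> (forall u v, Q u -> Q v -> Q (u + v)) ->
  forall u, Q u.
Proof.
move=> Q0 Qp QD u; rewrite (tensor_sum u).
by elim/big_ind: _ => // p _; exact: Qp.
Qed.

Section Lift.
Variables (V : zmodType) (f : A -> B -> V).
Hypothesis fbal : balanced f.

Lemma tliftE a b : tlift f (tpure a b) = f a b.
Proof. by rewrite tlift_class // big_seq1. Qed.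

Lemma tlift_is_additive : zmod_morphism (tlift f).
Proof.
have liftD u v : tlift f (u + v) = tlift f u + tlift f v.
  by rewrite -[u]tclassK -[v]tclassK -tclass_cat !tlift_class // big_cat.
move=> u v; apply: (addIr (tlift f v)); rewrite -liftD !subrK //.
Qed.

Lemma tliftD u v : tlift f (u + v) = tlift f u + tlift f v.
Proof. by rewrite -[u]tclassK -[v]tclassK -tclass_cat !tlift_class // big_cat. Qed.

Lemma tlift0 : tlift f 0 = 0.
Proof. by rewrite -[RHS](subrr (tlift f 0)) -tlift_is_additive subrr. Qed.

Lemma tlift_uniq (g : tensor -> V) : {morph g : u v / u + v} ->
  (forall a b, g (tpure a b) = f a b) -> g =1 tlift f.
Proof.
move=> gD gp; have g0 : g 0 = 0 by apply: (addrI (g 0)); rewrite -gD !addr0.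
elim/tensor_ind => [|a b|u v IHu IHv]; first by rewrite tlift0.
  by rewrite gp tliftE.
by rewrite gD IHu IHv tliftD.
Qed.

End Lift.

Lemma tliftZ (V : lmodType k) (f : A -> B -> V) :
  balanced f -> (forall c a b, f (c *: a) b = c *: f a b) ->
  forall c u, tlift f (c *: u) = c *: tlift f u.
Proof.
move=> fbal fZ c; elim/tensor_ind => [|a b|u v IHu IHv].
- by rewrite scaler0 tlift0 // scaler0.
- by rewrite -tpureZl !tliftE.
- by rewrite scalerDr !tliftD // IHu IHv scalerDr.
Qed.

Lemma eq_tlift (V : nmodType) (f g : A -> B -> V) u :
  (forall a b, f a b = g a b) -> tlift f u = tlift g u.
Proof. by move=> fg; apply: eq_bigr => p _; rewrite fg. Qed.

End Tensor.

Arguments tpure {k A B} a b.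
Arguments tlift {k A B V} f u.
Notation "a ⊗ b" := (tpure a b)
  (at level 40, left associativity) : ring_scope.

(* Over a field every nonzero vector is detected by a linear functional; this
   is what makes the tensor product of two nonzero algebras nonzero.          *)
Lemma linear_separates (k : fieldType) (V : lmodType k) (v : V) : v != 0 ->
  exists2 f : V -> k, scalar f & f v = 1.
Proof.
move=> v0.
pose sub (W : set V) := (forall a x y, W x -> W y -> W (a *: x + y)) /\ ~ W v.
have [|W [[WL Wv] Wmax]] := @Zorn_bigcup V sub.
  move=> F FP Ftot; split=> [a x y [W1 FW1 W1x] [W2 FW2 W2y]|[W /FP[_ +] //]].
  have [W12|W21] := Ftot _ _ FW1 FW2.
    by exists W2 => //; apply: (FP _ FW2).1 => //; exact: W12.
  by exists W1 => //; apply: (FP _ FW1).1 => //; exact: W21.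
have W0 : W 0.
  apply: contrapT => W0; apply: (Wmax [set 0]%classic).
    split=> [x Wx|/(_ 0 erefl) //]; exfalso; apply: W0.
    by have := WL (-1) _ _ Wx Wx; rewrite scaleN1r addNr.
  split=> [a x y -> ->|]; first by rewrite scaler0 addr0.
  by move=> /= v00; rewrite v00 eqxx in v0.
have WZ a x : W x -> W (a *: x) by move=> Wx; rewrite -[_ *: _]addr0; exact: WL.
have WD x y : W x -> W y -> W (x + y) by rewrite -{2}[x]scale1r; exact: WL.
have ex x : exists c, W (x - c *: v).
  have [Wx|Wx] := pselect (W x); first by exists 0; rewrite scale0r subr0.
  pose W' : set V := [set w + a *: x | a in setT & w in W]%classic.
  have W'v : W' v.
    apply: contrapT => nW'v; apply: (Wmax W').
      split=> [w Ww|/(_ x) W'W]; first by exists 0 => //; exists w; rewrite // scale0r addr0.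
      by apply/Wx/W'W; exists 1 => //; exists 0; rewrite // scale1r add0r.
    split=> // c _ _ [a _ [w Ww <-]] [b _ [w' Ww' <-]].
    exists (c * a + b) => //; exists (c *: w + w'); first exact: WL.
    by rewrite scalerDl scalerDr scalerA addrACA.
  case: W'v => a _ [w Ww wv].
  have a0 : a != 0.
    by apply: contra_notN Wv => /eqP a0; rewrite -wv a0 scale0r addr0.
  exists a^-1; have -> : x - a^-1 *: v = - a^-1 *: w.
    by rewrite -wv scalerDr scalerA mulVf // scale1r opprD addrC -addrA addNr addr0 scaleNr.
  exact: WZ.
have uniq c d x : W (x - c *: v) -> W (x - d *: v) -> c = d.
  move=> Wc Wd; apply/eqP; rewrite -subr_eq0; apply: contra_notT Wv => cd.
  have := WZ (c - d)^-1 _ (WD _ _ Wd (WZ (-1) _ Wc)).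
  have -> : x - d *: v + -1 *: (x - c *: v) = (c - d) *: v.
    by rewrite scaleN1r opprB addrC addrA subrK scalerBl.
  by rewrite scalerA mulVf // scale1r.
have [f fP] := choice ex.
exists f.
  move=> a x y /=; apply: uniq (fP _) _.
  have -> : a *: x + y - (a * f x + f y) *: v
          = a *: (x - f x *: v) + (y - f y *: v).
    by rewrite scalerDl scalerBr scalerA addrACA opprD.
  exact: WL.
by apply: uniq (fP _) _; rewrite scale1r subrr.
Qed.

Section TensorAlgebra.
Variables (k : fieldType) (A B : algType k).
Local Notation T := (tensor A B).

Definition tmul (u v : T) : T :=
  tlift (fun a b => tlift (fun a' b' => (a * a') ⊗ (b * b')) v) u.

Let mul1_balanced a b :
  balanced (fun a' b' => (a * a') ⊗ (b * b') : T).
Proof.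
split=> [y x x'|x y y'|c x y]; rewrite ?mulrDr ?tpureDl ?tpureDr //.
by rewrite -!scalerAr tpureZl tpureZr.
Qed.

Let mul_balanced v :
  balanced (fun a b => tlift (fun a' b' => (a * a') ⊗ (b * b') : T) v).
Proof.
split=> [b a a'|a b b'|c a b]; rewrite /tlift -?big_split /=;
  apply: eq_bigr => p _.
- by rewrite mulrDl tpureDl.
- by rewrite mulrDl tpureDr.
- by rewrite -!scalerAl tpureZl tpureZr.
Qed.

Let mulE a b a' b' : tmul (a ⊗ b) (a' ⊗ b') = (a * a') ⊗ (b * b').
Proof. by rewrite /tmul tliftE // tliftE. Qed.

Let mulDl : left_distributive tmul +%R.
Proof. by move=> u v w; rewrite /tmul tliftD. Qed.

Let mulDr : right_distributive tmul +%R.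
Proof.
move=> u v w; elim/tensor_ind: u => [|a b|u u' IHu IHu'].
- by rewrite /tmul !tlift0 // addr0.
- by rewrite /tmul !tliftE // tliftD.
- by rewrite !mulDl IHu IHu' addrACA.
Qed.

Let mul0 u : tmul u 0 = 0.
Proof. by apply: (addrI (tmul u 0)); rewrite -mulDr !addr0. Qed.

Let mul0l u : tmul 0 u = 0.
Proof. by rewrite /tmul tlift0. Qed.

Let mulA : associative tmul.
Proof.
move=> u v w; elim/tensor_ind: u => [|a b|u u' IHu IHu'].
- by rewrite !mul0l.
- elim/tensor_ind: v => [|a' b'|v v' IHv IHv'].
  + by rewrite !(mul0l, mul0).
  + elim/tensor_ind: w => [|a'' b''|w w' IHw IHw'].
    * by rewrite !mul0.
    * by rewrite !mulE !mulrA.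
    * by rewrite !mulDr IHw IHw'.
  + by rewrite mulDl !mulDr mulDl IHv IHv'.
- by rewrite !mulDl IHu IHu'.
Qed.

Let mul1l : left_id (1 ⊗ 1) tmul.
Proof.
elim/tensor_ind => [|a b|u v IHu IHv]; first exact: mul0.
  by rewrite mulE !mul1r.
by rewrite mulDr IHu IHv.
Qed.

Let mul1 : right_id (1 ⊗ 1) tmul.
Proof.
elim/tensor_ind => [|a b|u v IHu IHv]; first exact: mul0l.
  by rewrite mulE !mulr1.
by rewrite mulDl IHu IHv.
Qed.

Let one_neq0 : (1 ⊗ 1 : T) != 0.
Proof.
have [f fL f1] := linear_separates (oner_neq0 A).
have [g gL g1] := linear_separates (oner_neq0 B).
have fgbal : balanced (fun a b => f a * g b).
  have fD a a' : f (a + a') = f a + f a'.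
    by have := fL 1 a a'; rewrite scale1r mul1r.
  have gD a a' : g (a + a') = g a + g a'.
    by have := gL 1 a a'; rewrite scale1r mul1r.
  have f0 : f 0 = 0 by apply: (addrI (f 0)); rewrite -fD !addr0.
  have g0 : g 0 = 0 by apply: (addrI (g 0)); rewrite -gD !addr0.
  split=> [b a a'|a b b'|c a b]; rewrite ?fD ?gD ?mulrDl ?mulrDr //.
  have /= := fL c a 0; rewrite f0 !addr0 => ->.
  have /= := gL c b 0; rewrite g0 !addr0 => ->.
  by rewrite mulrCA mulrA.
apply/eqP => /(congr1 (tlift (fun a b => f a * g b))).
by rewrite tliftE // tlift0 // f1 g1 mulr1 => /eqP; rewrite oner_eq0.
Qed.

HB.instance Definition _ := GRing.Zmodule_isNzRing.Build T
  mulA mul1l mul1 mulDl mulDr one_neq0.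

Lemma tpureM a b a' b' : (a ⊗ b) * (a' ⊗ b') = (a * a') ⊗ (b * b') :> T.
Proof. exact: mulE. Qed.

Lemma tpure1 : 1 ⊗ 1 = 1 :> T. Proof. by []. Qed.

Let scaleAl (c : k) (u v : T) : c *: (u * v) = (c *: u) * v.
Proof.
elim/tensor_ind: u => [|a b|u u' IHu IHu'].
- by rewrite scaler0 !mul0r scaler0.
- elim/tensor_ind: v => [|a' b'|v v' IHv IHv'].
  + by rewrite !mulr0 scaler0.
  + by rewrite tpureM -!tpureZl tpureM scalerAl.
  + by rewrite !mulrDr scalerDr IHv IHv'.
- by rewrite mulrDl !scalerDr mulrDl IHu IHu'.
Qed.

HB.instance Definition _ := GRing.Lmodule_isLalgebra.Build k T scaleAl.

Let scaleAr (c : k) (u v : T) : c *: (u * v) = u * (c *: v).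
Proof.
elim/tensor_ind: u => [|a b|u u' IHu IHu'].
- by rewrite !mul0r scaler0.
- elim/tensor_ind: v => [|a' b'|v v' IHv IHv'].
  + by rewrite mulr0 !scaler0 mulr0.
  + by rewrite tpureM -!tpureZl tpureM scalerAr.
  + by rewrite scalerDr !mulrDr scalerDr IHv IHv'.
- by rewrite !mulrDl scalerDr IHu IHu'.
Qed.

HB.instance Definition _ := GRing.Lalgebra_isAlgebra.Build k T scaleAr.

End TensorAlgebra.

Definition tmap (k : fieldType) (A B A' B' : lmodType k)
    (f : A -> A') (g : B -> B') : tensor A B -> tensor A' B' :=
  tlift (fun a b => f a ⊗ g b).

Definition tassoc (k : fieldType) (A B C : lmodType k) :
    tensor (tensor A B) C -> tensor A (tensor B C) :=
  tlift (fun u c => tlift (fun a b => a ⊗ (b ⊗ c)) u).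

(* Sweedler sums [\sum f a_(1) a_(2)] are written [tlift f (comul a)].        *)
HB.mixin Record isHopf (k : fieldType) H of GRing.Algebra k H := {
  comul : {lrmorphism H -> tensor H H};
  counit : {lrmorphism H -> k^o};
  antipode : {linear H -> H};
  comulA : forall a : H,
    tassoc (tmap comul idfun (comul a)) = tmap idfun comul (comul a);
  counitl : forall a : H, tlift (fun b c => (counit b : k) *: c) (comul a) = a;
  counitr : forall a : H, tlift (fun b c => (counit c : k) *: b) (comul a) = a;
  antipodel : forall a : H,
    tlift (fun b c => antipode b * c) (comul a) = (counit a : k)%:A;
  antipoder : forall a : H,
    tlift (fun b c => b * antipode c) (comul a) = (counit a : k)%:A
}.

#[short(type="hopfType")]
HB.structure Definition Hopf (k : fieldType) :=
  {H of isHopf k H & GRing.Algebra k H}.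

(* The multiplicative halves of the duality; the additive halves are the
   bilinearity of [p].                                                        *)
Record hopf_pairing (k : fieldType) (H K : hopfType k)
    (p : {bilinear H -> K -> k | *%R & *%R}) : Prop := HopfPairing {
  pairing_mulr : forall a x y,
    p a (x * y) = tlift (fun a1 a2 => p a1 x * p a2 y) (comul a);
  pairing_mull : forall a b x,
    p (a * b) x = tlift (fun x1 x2 => p a x1 * p b x2) (comul x);
  pairing_antipode : forall a x, p (antipode a) x = p a (antipode x);
  pairing_counitl : forall a, p a 1 = counit a;
  pairing_counitr : forall x, p 1 x = counit x
}.

Definition nondegenerate_pairing (k : fieldType) (H K : lmodType k)
    (p : {bilinear H -> K -> k | *%R & *%R}) : Prop :=
  (forall a, (forall x, p a x = 0) -> a = 0) /\
  (forall x, (forall a, p a x = 0) -> x = 0).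

Section BalancedMaps.
Variables (k : fieldType) (A B : lmodType k).

Lemma tmap_balanced (A' B' : lmodType k)
    (f : {linear A -> A'}) (g : {linear B -> B'}) :
  balanced (fun a b => f a ⊗ g b).
Proof.
split=> [b a a'|a b b'|c a b]; rewrite ?linearD ?tpureDl ?tpureDr //.
by rewrite !linearZ /= tpureZl tpureZr.
Qed.

Lemma tassoc1_balanced (C : lmodType k) (c : C) :
  balanced (fun (a : A) (b : B) => a ⊗ (b ⊗ c)).
Proof.
split=> [b a a'|a b b'|d a b]; rewrite ?tpureDl ?tpureDr //.
by rewrite !(tpureZl, tpureZr).
Qed.

Lemma tassoc_balanced (C : lmodType k) :
  balanced (fun (u : tensor A B) (c : C) => tlift (fun a b => a ⊗ (b ⊗ c)) u).
Proof.
split=> [c u v|u c c'|d u c].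
- exact/tliftD/tassoc1_balanced.
- by rewrite /tlift -big_split; apply: eq_bigr => p _ /=; rewrite !tpureDr.
- rewrite tliftZ; first 1 last.
  + exact: tassoc1_balanced.
  + by move=> e a b; rewrite tpureZl.
  by rewrite /tlift scaler_sumr; apply: eq_bigr => p _; rewrite !tpureZr.
Qed.

End BalancedMaps.

Section AlgebraMaps.
Variables (k : fieldType).

Lemma tmapM (A B A' B' : algType k)
    (f : {lrmorphism A -> A'}) (g : {lrmorphism B -> B'}) u v :
  tmap f g (u * v) = tmap f g u * tmap f g v.
Proof.
have bal := tmap_balanced f g; rewrite /tmap.
elim/tensor_ind: u => [|a b|u u' IHu IHu'].
- by rewrite mul0r !tlift0 // mul0r.
- elim/tensor_ind: v => [|a' b'|v v' IHv IHv'].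
  + by rewrite mulr0 !tlift0 // mulr0.
  + by rewrite tpureM !tliftE // !rmorphM tpureM.
  + by rewrite mulrDr !tliftD // mulrDr IHv IHv'.
- by rewrite mulrDl !tliftD // mulrDl IHu IHu'.
Qed.

Lemma tmap1 (A B A' B' : algType k)
    (f : {lrmorphism A -> A'}) (g : {lrmorphism B -> B'}) : tmap f g 1 = 1.
Proof.
rewrite -[in LHS]tpure1 /tmap tliftE ?rmorph1 //; exact: tmap_balanced.
Qed.

Lemma tmapE (A B A' B' : lmodType k)
    (f : {linear A -> A'}) (g : {linear B -> B'}) a b :
  tmap f g (a ⊗ b) = f a ⊗ g b.
Proof. by rewrite /tmap tliftE //; exact: tmap_balanced. Qed.

Lemma tmapD (A B A' B' : lmodType k)
    (f : {linear A -> A'}) (g : {linear B -> B'}) u v :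
  tmap f g (u + v) = tmap f g u + tmap f g v.
Proof. by rewrite /tmap tliftD //; exact: tmap_balanced. Qed.

Lemma tassocE (A B C : lmodType k) (a : A) (b : B) (c : C) :
  tassoc ((a ⊗ b) ⊗ c) = a ⊗ (b ⊗ c).
Proof.
rewrite /tassoc tliftE; last exact: tassoc_balanced.
by rewrite tliftE //; exact: tassoc1_balanced.
Qed.

Lemma tassocD (A B C : lmodType k) (u v : tensor (tensor A B) C) :
  tassoc (u + v) = tassoc u + tassoc v.
Proof. exact/tliftD/tassoc_balanced. Qed.

Lemma tassoc0 (A B C : lmodType k) : tassoc (0 : tensor (tensor A B) C) = 0.
Proof. exact/tlift0/tassoc_balanced. Qed.

Lemma tensor3_ind (A B C : lmodType k) (Q : tensor (tensor A B) C -> Prop) :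
  Q 0 -> (forall a b c, Q ((a ⊗ b) ⊗ c)) ->
  (forall u v, Q u -> Q v -> Q (u + v)) -> forall u, Q u.
Proof.
move=> Q0 Qp QD; elim/tensor_ind => // u c.
elim/tensor_ind: u => // [|u v IHu IHv]; last by rewrite tpureDl; exact: QD.
by rewrite -(scale0r 0) tpureZl scale0r.
Qed.

Lemma tassocM (A B C : algType k) (u v : tensor (tensor A B) C) :
  tassoc (u * v) = tassoc u * tassoc v.
Proof.
elim/tensor3_ind: u => [|a b c|u u' IHu IHu'].
- by rewrite mul0r !tassoc0 mul0r.
- elim/tensor3_ind: v => [|a' b' c'|v v' IHv IHv'].
  + by rewrite mulr0 !tassoc0 mulr0.
  + by rewrite !tpureM !tassocE !tpureM.
  + by rewrite mulrDr !tassocD mulrDr IHv IHv'.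
- by rewrite mulrDl !tassocD mulrDl IHu IHu'.
Qed.

HB.instance Definition _ (A : lmodType k) := GRing.Lmodule.on A^c.

Let convAl (A : algType k) (c : k) (u v : A^c) : c *: (u * v) = (c *: u : A^c) * v.
Proof. exact: (@scalerAr k A c v u). Qed.
HB.instance Definition _ (A : algType k) :=
  GRing.Lmodule_isLalgebra.Build k A^c (@convAl A).
Let convAr (A : algType k) (c : k) (u v : A^c) : c *: (u * v) = u * (c *: v : A^c).
Proof. exact: (@scalerAl k A c v u). Qed.
HB.instance Definition _ (A : algType k) :=
  GRing.Lalgebra_isAlgebra.Build k A^c (@convAr A).

End AlgebraMaps.

Section PresentedHopf.
Variables (k : fieldType) (P : presentation k).
Local Notation H := (presented P).
Variables (D : {lrmorphism H -> tensor H H}) (e : {lrmorphism H -> k^o}).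
Variable S : {lrmorphism H -> H^c}.

Let SM (a b : H) : S (a * b) = (S b : H) * (S a : H).
Proof. exact: rmorphM. Qed.

Lemma presented_comulA :
  (forall g, tassoc (tmap D idfun (D (pgen P g))) =
             tmap idfun D (D (pgen P g))) ->
  forall a : H, tassoc (tmap D idfun (D a)) = tmap idfun D (D a).
Proof.
have b1 := tmap_balanced D (idfun : {linear H -> H}).
have b2 := tmap_balanced (idfun : {linear H -> H}) D.
have h1 : tassoc (tmap D idfun (D 1)) = tmap idfun D (D 1).
  by rewrite rmorph1 !tmap1 -!tpure1 tassocE.
move=> Dg; elim/presented_ind => [c|//|x y IHx IHy|x y IHx IHy].
- rewrite linearZ /= /tmap !tliftZ //; first 1 last.
  + by move=> d a b; rewrite /= tpureZl.
  + by move=> d a b; rewrite /= linearZ /= tpureZl.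
  rewrite -/(tmap _ _ _) -/(tmap _ _ _) -h1 /tassoc tliftZ //.
    exact: tassoc_balanced.
  move=> d u b; apply: tliftZ; first exact: tassoc1_balanced.
  by move=> *; rewrite tpureZl.
- by rewrite linearD /= /tmap !tliftD // tassocD [X in X + _]IHx [X in _ + X]IHy.
- by rewrite rmorphM /= !tmapM tassocM IHx IHy.
Qed.

Lemma presented_counitl_balanced : balanced (fun b c => (e b : k) *: (c : H)).
Proof.
split=> [b a a'|a b b'|c a b]; rewrite ?linearD ?scalerDl ?scalerDr //.
by rewrite linearZ /= scalerA mulrC.
Qed.

Lemma presented_counitr_balanced : balanced (fun b c => (e c : k) *: (b : H)).
Proof.
split=> [b a a'|a b b'|c a b]; rewrite ?linearD ?scalerDl ?scalerDr //.
by rewrite scalerA mulrC [e (c *: b)]linearZ.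
Qed.

#[local] Hint Resolve presented_counitl_balanced : core.
#[local] Hint Resolve presented_counitr_balanced : core.

Let lM (u v : tensor H H) :
  tlift (fun b c => e b *: c) (u * v) =
  tlift (fun b c => e b *: c) u * tlift (fun b c => e b *: c) v :> H.
Proof.
elim/tensor_ind: u => [|a b|u u' IHu IHu'].
- by rewrite mul0r !tlift0 // mul0r.
- elim/tensor_ind: v => [|a' b'|v v' IHv IHv'].
  + by rewrite mulr0 !tlift0 // mulr0.
  + by rewrite tpureM !tliftE // rmorphM -scalerAl -scalerAr scalerA.
  + by rewrite mulrDr !tliftD // mulrDr IHv IHv'.
- by rewrite mulrDl !tliftD // mulrDl IHu IHu'.
Qed.

Let rM (u v : tensor H H) :
  tlift (fun b c => e c *: b) (u * v) =
  tlift (fun b c => e c *: b) u * tlift (fun b c => e c *: b) v :> H.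
Proof.
elim/tensor_ind: u => [|a b|u u' IHu IHu'].
- by rewrite mul0r !tlift0 // mul0r.
- elim/tensor_ind: v => [|a' b'|v v' IHv IHv'].
  + by rewrite mulr0 !tlift0 // mulr0.
  + by rewrite tpureM !tliftE // rmorphM -scalerAl -scalerAr scalerA.
  + by rewrite mulrDr !tliftD // mulrDr IHv IHv'.
- by rewrite mulrDl !tliftD // mulrDl IHu IHu'.
Qed.

Lemma presented_counitl :
  (forall g, tlift (fun b c => e b *: c) (D (pgen P g)) = pgen P g) ->
  forall a : H, tlift (fun b c => e b *: c) (D a) = a.
Proof.
move=> Dg; elim/presented_ind => [c|//|x y IHx IHy|x y IHx IHy].
- rewrite linearZ /= tliftZ //; last by move=> d a b; rewrite linearZ /= scalerA.
  by rewrite rmorph1 -tpure1 tliftE // rmorph1 scale1r.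
- by rewrite linearD /= tliftD // IHx IHy.
- by rewrite rmorphM /= lM IHx IHy.
Qed.

Lemma presented_counitr :
  (forall g, tlift (fun b c => e c *: b) (D (pgen P g)) = pgen P g) ->
  forall a : H, tlift (fun b c => e c *: b) (D a) = a.
Proof.
move=> Dg; elim/presented_ind => [c|//|x y IHx IHy|x y IHx IHy].
- rewrite linearZ /= tliftZ //; last first.
    by move=> d a b; rewrite !scalerA mulrC.
  by rewrite rmorph1 -tpure1 tliftE // rmorph1 scale1r.
- by rewrite linearD /= tliftD // IHx IHy.
- by rewrite rmorphM /= rM IHx IHy.
Qed.

Lemma presented_antipodel_balanced : balanced (fun b c : H => (S b : H) * c).
Proof.
split=> [b a a'|a b b'|c a b]; rewrite ?linearD ?mulrDr //; first exact: mulrDl.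
by rewrite linearZ /= -scalerAr; exact/esym/scalerAl.
Qed.

Lemma presented_antipoder_balanced : balanced (fun b c : H => b * (S c : H)).
Proof.
split=> [b a a'|a b b'|c a b]; rewrite ?linearD ?mulrDl //; first exact: mulrDr.
by rewrite linearZ /= -scalerAl; exact: scalerAr.
Qed.

#[local] Hint Resolve presented_antipodel_balanced : core.
#[local] Hint Resolve presented_antipoder_balanced : core.

Let slM (u v : tensor H H) (c : k) :
  tlift (fun b c => (S b : H) * c) u = c%:A ->
  tlift (fun b c => (S b : H) * c) (u * v) =
  c *: tlift (fun b c => (S b : H) * c) v.
Proof.
move=> uc; elim/tensor_ind: v => [|a b|v v' IHv IHv'].
- by rewrite mulr0 !tlift0 // scaler0.
- have -> : tlift (fun b c => (S b : H) * c) (u * (a ⊗ b)) =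
            (S a : H) * tlift (fun b c => (S b : H) * c) u * b.
    elim/tensor_ind: u {uc} => [|a' b'|u u' IHu IHu'].
    + by rewrite mul0r !tlift0 // mulr0 mul0r.
    + by rewrite tpureM !tliftE // SM !mulrA.
    + by rewrite mulrDl !tliftD // mulrDr mulrDl IHu IHu'.
  by rewrite uc tliftE // -scalerAr mulr1 -scalerAl.
- by rewrite mulrDr !tliftD // scalerDr IHv IHv'.
Qed.

Let srM (u v : tensor H H) (c : k) :
  tlift (fun b c => b * (S c : H)) v = c%:A ->
  tlift (fun b c => b * (S c : H)) (u * v) =
  c *: tlift (fun b c => b * (S c : H)) u.
Proof.
move=> vc; elim/tensor_ind: u => [|a b|u u' IHu IHu'].
- by rewrite mul0r !tlift0 // scaler0.
- have -> : tlift (fun b c => b * (S c : H)) ((a ⊗ b) * v) =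
            a * tlift (fun b c => b * (S c : H)) v * (S b : H).
    elim/tensor_ind: v {vc} => [|a' b'|v v' IHv IHv'].
    + by rewrite mulr0 !tlift0 // mulr0 mul0r.
    + by rewrite tpureM !tliftE // SM !mulrA.
    + by rewrite mulrDr !tliftD // mulrDr mulrDl IHv IHv'.
  by rewrite vc tliftE // -scalerAr mulr1 -scalerAl.
- by rewrite mulrDl !tliftD // scalerDr IHu IHu'.
Qed.

Let S1 : S 1 = 1 :> H.
Proof. exact: (rmorph1 S). Qed.

Lemma presented_antipodel :
  (forall g, tlift (fun b c => (S b : H) * c) (D (pgen P g)) =
             (e (pgen P g) : k)%:A) ->
  forall a : H, tlift (fun b c => (S b : H) * c) (D a) = (e a : k)%:A.
Proof.
move=> Dg; elim/presented_ind => [c|//|x y IHx IHy|x y IHx IHy].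
- rewrite !linearZ /= tliftZ //; last first.
    by move=> d a b; rewrite linearZ /=; exact/esym/scalerAl.
  rewrite !rmorph1 -tpure1 tliftE // S1 mulr1; congr (_ *: _).
  exact/esym/mulr1.
- by rewrite !linearD /= tliftD // IHx IHy scalerDl.
- by rewrite !rmorphM /= (slM _ IHx) IHy scalerA.
Qed.

Lemma presented_antipoder :
  (forall g, tlift (fun b c => b * (S c : H)) (D (pgen P g)) =
             (e (pgen P g) : k)%:A) ->
  forall a : H, tlift (fun b c => b * (S c : H)) (D a) = (e a : k)%:A.
Proof.
move=> Dg; elim/presented_ind => [c|//|x y IHx IHy|x y IHx IHy].
- rewrite !linearZ /= tliftZ //; last first.
    by move=> d a b; exact/esym/scalerAl.
  rewrite !rmorph1 -tpure1 tliftE // S1 mulr1; congr (_ *: _).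
  exact/esym/mulr1.
- by rewrite !linearD /= tliftD // IHx IHy scalerDl.
- by rewrite !rmorphM /= (srM _ IHy) IHx scalerA mulrC.
Qed.

End PresentedHopf.

Section Commutators.
Variables (k : fieldType) (A B : algType k).

Definition lie (a b : A) : A := a * b - b * a.

Lemma lieDl a a' b : lie (a + a') b = lie a b + lie a' b.
Proof. by rewrite /lie mulrDl mulrDr opprD addrACA. Qed.
Lemma lieDr a b b' : lie a (b + b') = lie a b + lie a b'.
Proof. by rewrite /lie mulrDl mulrDr opprD addrACA. Qed.
Lemma lieNl a b : lie (- a) b = - lie a b.
Proof. by rewrite /lie mulNr mulrN opprB opprK addrC. Qed.
Lemma lieNr a b : lie a (- b) = - lie a b.
Proof. by rewrite /lie mulNr mulrN opprB opprK addrC. Qed.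
Lemma lie_anti a b : lie a b = - lie b a.
Proof. by rewrite /lie opprB. Qed.
Lemma liexx a : lie a a = 0. Proof. exact: subrr. Qed.
Lemma lie1l a : lie 1 a = 0. Proof. by rewrite /lie mul1r mulr1 subrr. Qed.
Lemma lie1r a : lie a 1 = 0. Proof. by rewrite /lie mul1r mulr1 subrr. Qed.
Lemma lieMr a b c : lie a (b * c) = lie a b * c + b * lie a c.
Proof. by rewrite /lie mulrBl mulrBr !mulrA addrA subrK. Qed.
Lemma lieMl a b c : lie (a * b) c = lie a c * b + a * lie b c.
Proof. by rewrite /lie mulrBl mulrBr !mulrA [RHS]addrC addrA subrK. Qed.

End Commutators.

Lemma lie_pure (k : fieldType) (A B : algType k) (a a' : A) (b b' : B) :
  lie (a ⊗ b) (a' ⊗ b') = lie a a' ⊗ (b * b') + (a' * a) ⊗ lie b b'.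
Proof.
rewrite /lie !tpureM -!scaleN1r !(tpureDl, tpureDr) tpureZl tpureZr addrA.
by rewrite !scaleN1r subrK.
Qed.

Lemma tpure0l (k : fieldType) (A B : lmodType k) (b : B) :
  (0 : A) ⊗ b = 0.
Proof. by rewrite -(scale0r 0) tpureZl scale0r. Qed.

Lemma tpure0r (k : fieldType) (A B : lmodType k) (a : A) :
  a ⊗ (0 : B) = 0.
Proof. by rewrite -(scale0r 0) tpureZr scale0r. Qed.

Lemma lie_conv (k : fieldType) (A : algType k) (a b : A) :
  lie (a : A^c) (b : A^c) = lie b a :> A.
Proof. by []. Qed.

Lemma peval_lie (k : fieldType) (B : algType k) G (f : G -> B) s t :
  peval f (s * t - t * s)%pt = lie (peval f s) (peval f t).
Proof. by rewrite /= scaleN1r mulN1r. Qed.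

Lemma peval_scale (k : fieldType) (B : algType k) G (f : G -> B) c s :
  peval f (c%:PT * s)%pt = c *: peval f s.
Proof. by rewrite /= -scalerAl mul1r. Qed.

Lemma two_neq0 (k : fieldType) : [pchar k] =i pred0 -> (2 : k) != 0.
Proof. by move=> /pcharf0P ->. Qed.

Lemma half_double (k : fieldType) (k0 : [pchar k] =i pred0) (a : k) :
  a = a / 2 + a / 2.
Proof. by rewrite -mulrDl -mulr2n -[a *+ 2]mulr_natr mulfK // two_neq0. Qed.

Inductive heis_gen : Type := GenX | GenY | GenT.

Section HeisRelations.
Variables (k : fieldType) (lambda : k).
Local Notation X := (PGen GenX).
Local Notation Y := (PGen GenY).
Local Notation t := (PGen GenT).

Inductive heis_rel : pterm k heis_gen -> pterm k heis_gen -> Prop :=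
| heis_rel_YX : heis_rel (Y * X - X * Y)%pt (lambda%:PT * X)%pt
| heis_rel_Xt : heis_rel (X * t - t * X)%pt ((lambda / 2)%R%:PT * (t * t))%pt
| heis_rel_Yt : heis_rel (Y * t - t * Y)%pt (lambda%:PT * t)%pt.

Lemma heis_relP (B : algType k) (f : heis_gen -> B) :
  lie (f GenY) (f GenX) = lambda *: f GenX ->
  lie (f GenX) (f GenT) = (lambda / 2) *: (f GenT * f GenT) ->
  lie (f GenY) (f GenT) = lambda *: f GenT ->
  forall s t, heis_rel s t -> peval f s = peval f t.
Proof. by move=> YX Xt Yt _ _ []; rewrite peval_lie peval_scale. Qed.

Let heis_counit : forall s t, heis_rel s t ->
  peval (fun=> 0 : k^o) s = peval (fun=> 0) t.
Proof. by apply: heis_relP; rewrite liexx ?mulr0 scaler0. Qed.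

Definition heis_presentation : presentation k :=
  Presentation (proper_of_model heis_counit).

End HeisRelations.

(* Since 2^-1 = 0 in characteristic 2, the coproduct is defined only when 2 is
   invertible; the carrier takes the assumption on the characteristic as a
   parameter so that the Hopf structure can be found from the type.           *)
Definition kHeis (k : fieldType) (k0 : [pchar k] =i pred0) (lambda : k) : Type :=
  presented (heis_presentation lambda).

Section Heis.
Variables (k : fieldType) (k0 : [pchar k] =i pred0) (lambda : k).
Local Notation H := (kHeis k0 lambda).
Local Notation P := (heis_presentation lambda).

HB.instance Definition _ := GRing.Algebra.on H.

Definition hX : H := pgen P GenX.
Definition hY : H := pgen P GenY.
Definition ht : H := pgen P GenT.

Lemma hYX : lie hY hX = lambda *: hX.
Proof. by have := @pgen_rel _ P _ _ (heis_rel_YX lambda); rewrite peval_lie peval_scale. Qed.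
Lemma hXt : lie hX ht = (lambda / 2) *: (ht * ht).
Proof. by have := @pgen_rel _ P _ _ (heis_rel_Xt lambda); rewrite peval_lie peval_scale. Qed.
Lemma hYt : lie hY ht = lambda *: ht.
Proof. by have := @pgen_rel _ P _ _ (heis_rel_Yt lambda); rewrite peval_lie peval_scale. Qed.

Definition heis_comul_gen (g : heis_gen) : tensor H H :=
  match g with
  | GenX => hX ⊗ 1 + 1 ⊗ hX + hY ⊗ ht
  | GenY => hY ⊗ 1 + 1 ⊗ hY
  | GenT => ht ⊗ 1 + 1 ⊗ ht
  end.

Definition heis_antipode_gen (g : heis_gen) : H^c :=
  match g with
  | GenX => - hX + hY * ht
  | GenY => - hY
  | GenT => - ht
  end.

Lemma heis_comul_rel s t : heis_rel lambda s t ->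
  peval heis_comul_gen s = peval heis_comul_gen t.
Proof.
apply: heis_relP => {s t} /=.
- rewrite !(lieDl, lieDr) !lie_pure !(liexx, lie1l, lie1r) hYX hYt.
  rewrite !(tpure0l, tpure0r, mul1r, mulr1, addr0, add0r).
  by rewrite !(tpureZl, tpureZr) !scalerDr addrA.
- rewrite !(lieDl, lieDr) !lie_pure !(liexx, lie1l, lie1r) hXt hYt.
  rewrite !(tpure0l, tpure0r, mul1r, mulr1, addr0, add0r).
  rewrite !(mulrDl, mulrDr) !tpureM !(mul1r, mulr1).
  rewrite !(tpureZl, tpureZr) !scalerDr -!addrA; congr (_ + _).
  rewrite addrC !addrA -scalerDl; congr (_ *: _ + _).
  by rewrite -half_double.
- rewrite !(lieDl, lieDr) !lie_pure !(liexx, lie1l, lie1r) hYt.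
  rewrite !(tpure0l, tpure0r, mul1r, mulr1, addr0, add0r).
  by rewrite !(tpureZl, tpureZr) !scalerDr.
Qed.

Lemma heis_counit_rel s t : heis_rel lambda s t ->
  peval (fun=> 0 : k^o) s = peval (fun=> 0) t.
Proof. by apply: heis_relP; rewrite liexx ?mulr0 scaler0. Qed.

Lemma heis_antipode_rel s t : heis_rel lambda s t ->
  peval heis_antipode_gen s = peval heis_antipode_gen t.
Proof.
apply: heis_relP => {s t} /=; rewrite lie_conv.
- rewrite lieDl !(lieNl, lieNr) opprK lieMl liexx mul0r add0r.
  rewrite [lie hX hY]lie_anti [lie ht hY]lie_anti hYX hYt.
  by rewrite mulrN opprK scalerDr scalerN -scalerAr.
- have -> : (- ht : H^c) * (- ht : H^c) = ht * ht :> H by exact: mulrNN.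
  rewrite lieDr !(lieNl, lieNr) opprK lieMr liexx mulr0 addr0.
  rewrite [lie ht hX]lie_anti [lie ht hY]lie_anti hXt hYt mulNr opprK -scalerAl.
  rewrite addrC -scaleNr -scalerDl; congr (_ *: _).
  by rewrite {1}(half_double k0 lambda) addrK.
- by rewrite lieNl lieNr opprK lie_anti hYt scalerN.
Qed.

Definition heis_comul : {lrmorphism H -> tensor H H} :=
  plift (P := P) heis_comul_rel.
Definition heis_counit : {lrmorphism H -> k^o} :=
  plift (P := P) heis_counit_rel.
Definition heis_antipode : {lrmorphism H -> H^c} :=
  plift (P := P) heis_antipode_rel.

Let DX : heis_comul hX = hX ⊗ 1 + 1 ⊗ hX + hY ⊗ ht.
Proof. exact: (plift_gen (P := P) heis_comul_rel GenX). Qed.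
Let DY : heis_comul hY = hY ⊗ 1 + 1 ⊗ hY.
Proof. exact: (plift_gen (P := P) heis_comul_rel GenY). Qed.
Let Dt : heis_comul ht = ht ⊗ 1 + 1 ⊗ ht.
Proof. exact: (plift_gen (P := P) heis_comul_rel GenT). Qed.
Let D1 : heis_comul 1 = 1 ⊗ 1. Proof. exact: rmorph1. Qed.
Let e0 g : heis_counit (pgen P g) = 0.
Proof. exact: (plift_gen (P := P) heis_counit_rel g). Qed.
Let e1 : heis_counit 1 = 1. Proof. exact: rmorph1. Qed.
Let SX : heis_antipode hX = - hX + hY * ht :> H. Proof. exact: (plift_gen (P := P) heis_antipode_rel GenX). Qed.
Let SY : heis_antipode hY = - hY :> H. Proof. exact: (plift_gen (P := P) heis_antipode_rel GenY). Qed.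
Let St : heis_antipode ht = - ht :> H. Proof. exact: (plift_gen (P := P) heis_antipode_rel GenT). Qed.
Let S1 : heis_antipode 1 = 1 :> H. Proof. exact: (rmorph1 heis_antipode). Qed.

Lemma heis_comulA (a : H) :
  tassoc (tmap heis_comul idfun (heis_comul a)) =
  tmap idfun heis_comul (heis_comul a).
Proof.
move: a; apply: presented_comulA; case.
- rewrite DX !tmapD !tmapE /= DX DY Dt D1 !(tpureDl, tpureDr) !tassocD !tassocE.
  rewrite -!addrA; do 2?congr (_ + _).
  by rewrite addrCA; congr (_ + _); rewrite addrA addrC.
- rewrite DY !tmapD !tmapE /= DY D1 !(tpureDl, tpureDr) !tassocD !tassocE.
  by rewrite addrA.
- rewrite Dt !tmapD !tmapE /= Dt D1 !(tpureDl, tpureDr) !tassocD !tassocE.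
  by rewrite addrA.
Qed.

Lemma heis_counitl (a : H) :
  tlift (fun b c => (heis_counit b : k) *: c) (heis_comul a) = a.
Proof.
have bal := presented_counitl_balanced heis_counit.
move: a; apply: presented_counitl; case.
- by rewrite DX !tliftD // !tliftE // !e0 e1 !scale0r scale1r add0r addr0.
- by rewrite DY !tliftD // !tliftE // !e0 e1 !scale0r scale1r add0r.
- by rewrite Dt !tliftD // !tliftE // !e0 e1 !scale0r scale1r add0r.
Qed.

Lemma heis_counitr (a : H) :
  tlift (fun b c => (heis_counit c : k) *: b) (heis_comul a) = a.
Proof.
have bal := presented_counitr_balanced heis_counit.
move: a; apply: presented_counitr; case.
- by rewrite DX !tliftD // !tliftE // !e0 e1 !scale0r scale1r !addr0.
- by rewrite DY !tliftD // !tliftE // !e0 e1 !scale0r scale1r addr0.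
- by rewrite Dt !tliftD // !tliftE // !e0 e1 !scale0r scale1r addr0.
Qed.

Lemma heis_antipodel (a : H) :
  tlift (fun b c => (heis_antipode b : H) * c) (heis_comul a) =
  (heis_counit a : k)%:A.
Proof.
have bal := presented_antipodel_balanced heis_antipode.
move: a; apply: presented_antipodel; case; rewrite e0 scale0r.
- rewrite DX !tliftD // !tliftE // SX SY S1 mulr1 mul1r mulNr.
  by rewrite [- hX + _]addrC addrNK subrr.
- by rewrite DY !tliftD // !tliftE // SY S1 mulr1 mul1r addNr.
- by rewrite Dt !tliftD // !tliftE // St S1 mulr1 mul1r addNr.
Qed.

Lemma heis_antipoder (a : H) :
  tlift (fun b c => b * (heis_antipode c : H)) (heis_comul a) =
  (heis_counit a : k)%:A.
Proof.
have bal := presented_antipoder_balanced heis_antipode.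
move: a; apply: presented_antipoder; case; rewrite e0 scale0r.
- rewrite DX !tliftD // !tliftE // SX St S1 mulr1 mul1r mulrN addrA subrr.
  by rewrite add0r subrr.
- by rewrite DY !tliftD // !tliftE // SY S1 mulr1 mul1r subrr.
- by rewrite Dt !tliftD // !tliftE // St S1 mulr1 mul1r subrr.
Qed.

Let antipode_linear : linear (heis_antipode : H -> H).
Proof. exact: (linearP heis_antipode). Qed.
Definition heis_antipode_lin : H -> H := heis_antipode.
HB.instance Definition _ :=
  GRing.isLinear.Build k H H *:%R heis_antipode_lin antipode_linear.

HB.instance Definition _ := isHopf.Build k H
  heis_comulA heis_counitl heis_counitr
  (heis_antipodel : forall a, tlift (fun b c => heis_antipode_lin b * c) _ = _)
  heis_antipoder.

Lemma comul_hX : comul hX = hX ⊗ 1 + 1 ⊗ hX + hY ⊗ ht. Proof. exact: DX. Qed.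
Lemma comul_hY : comul hY = hY ⊗ 1 + 1 ⊗ hY. Proof. exact: DY. Qed.
Lemma comul_ht : comul ht = ht ⊗ 1 + 1 ⊗ ht. Proof. exact: Dt. Qed.
Lemma counit_hX : counit hX = 0. Proof. exact: e0. Qed.
Lemma counit_hY : counit hY = 0. Proof. exact: e0. Qed.
Lemma counit_ht : counit ht = 0. Proof. exact: e0. Qed.
Lemma antipode_hX : antipode hX = - hX + hY * ht. Proof. exact: SX. Qed.
Lemma antipode_hY : antipode hY = - hY. Proof. exact: SY. Qed.
Lemma antipode_ht : antipode ht = - ht. Proof. exact: St. Qed.

End Heis.

Inductive uheis_gen : Type := GenZ | GenA | GenAinv | GenB.

Section UheisRelations.
Variables (k : fieldType) (lambda : k).
Local Notation z := (PGen GenZ).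
Local Notation a := (PGen GenA).
Local Notation a' := (PGen GenAinv).
Local Notation b := (PGen GenB).

(* The coefficients of the last two relations are the only ones compatible with
   everything else. With the coproduct below, [z, a] = c a b forces
   [z, b] = (c / 2) b^2; a pairing with k_lambda[Heis] such that
   <t, z> = <X, b> = 1, <Y, a> = lambda, <X, a> = <X, z> = 0 then forces
   c = <X, [z, a]> = - <Y, a> <t, z> = - lambda.                              *)
Inductive uheis_rel : pterm k uheis_gen -> pterm k uheis_gen -> Prop :=
| uheis_rel_aa' : uheis_rel (a * a')%pt 1%:PT%pt
| uheis_rel_a'a : uheis_rel (a' * a)%pt 1%:PT%pt
| uheis_rel_ab : uheis_rel (a * b - b * a)%pt 0%:PT%pt
| uheis_rel_za : uheis_rel (z * a - a * z)%pt ((- lambda)%R%:PT * (a * b))%pt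
| uheis_rel_zb :
    uheis_rel (z * b - b * z)%pt ((- (lambda / 2))%R%:PT * (b * b))%pt.

Lemma uheis_relP (B : algType k) (f : uheis_gen -> B) :
  f GenA * f GenAinv = 1 -> f GenAinv * f GenA = 1 ->
  lie (f GenA) (f GenB) = 0 ->
  lie (f GenZ) (f GenA) = - lambda *: (f GenA * f GenB) ->
  lie (f GenZ) (f GenB) = - (lambda / 2) *: (f GenB * f GenB) ->
  forall s t, uheis_rel s t -> peval f s = peval f t.
Proof.
move=> aa' a'a ab za zb _ _ [] //; rewrite ?peval_lie ?peval_scale //=.
- by rewrite aa' scale1r.
- by rewrite a'a scale1r.
- by rewrite ab scale0r.
Qed.

Definition uheis_counit_gen (g : uheis_gen) : k^o :=
  match g with GenZ => 0 | GenA => 1 | GenAinv => 1 | GenB => 0 end.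

Lemma uheis_counit_rel s t : uheis_rel s t ->
  peval uheis_counit_gen s = peval uheis_counit_gen t.
Proof.
by apply: uheis_relP; rewrite /= ?mulr1 ?lie1l ?lie1r ?liexx ?mulr0 ?scaler0.
Qed.

Definition uheis_presentation : presentation k :=
  Presentation (proper_of_model uheis_counit_rel).

End UheisRelations.

Definition Uheis (k : fieldType) (k0 : [pchar k] =i pred0) (lambda : k) : Type :=
  presented (uheis_presentation lambda).

Section Uheis.
Variables (k : fieldType) (k0 : [pchar k] =i pred0) (lambda : k).
Local Notation U := (Uheis k0 lambda).
Local Notation P := (uheis_presentation lambda).

HB.instance Definition _ := GRing.Algebra.on U.

Definition uz : U := pgen P GenZ.
Definition ualpha : U := pgen P GenA.
Definition ualphaV : U := pgen P GenAinv.
Definition ubeta : U := pgen P GenB.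

Definition ualpha_exp (q : int) : U :=
  match q with
  | Posz n => ualpha ^+ n
  | Negz n => ualphaV ^+ n.+1
  end.

Lemma ualphaK : ualpha * ualphaV = 1.
Proof. by have := @pgen_rel _ P _ _ (uheis_rel_aa' lambda); rewrite /= scale1r. Qed.
Lemma ualphaVK : ualphaV * ualpha = 1.
Proof. by have := @pgen_rel _ P _ _ (uheis_rel_a'a lambda); rewrite /= scale1r. Qed.
Lemma ualphabeta : lie ualpha ubeta = 0.
Proof.
by have := @pgen_rel _ P _ _ (uheis_rel_ab lambda); rewrite peval_lie /= scale0r.
Qed.
Lemma uzalpha : lie uz ualpha = - lambda *: (ualpha * ubeta).
Proof.
by have := @pgen_rel _ P _ _ (uheis_rel_za lambda); rewrite peval_lie peval_scale.
Qed.
Lemma uzbeta : lie uz ubeta = - (lambda / 2) *: (ubeta * ubeta).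
Proof.
by have := @pgen_rel _ P _ _ (uheis_rel_zb lambda); rewrite peval_lie peval_scale.
Qed.

Let ab : ualpha * ubeta = ubeta * ualpha.
Proof. exact/subr0_eq/ualphabeta. Qed.

Let a'b : ualphaV * ubeta = ubeta * ualphaV.
Proof.
rewrite -[LHS]mulr1 -ualphaK mulrA -(mulrA ualphaV) -ab.
by rewrite mulrA ualphaVK mul1r.
Qed.

Let za' : lie uz ualphaV = lambda *: (ubeta * ualphaV).
Proof.
have : lie uz (ualpha * ualphaV) = 0 by rewrite ualphaK lie1r.
rewrite lieMr uzalpha => /eqP; rewrite addrC addr_eq0 => /eqP h.
rewrite -[LHS]mul1r -ualphaVK -mulrA h -scalerAl scaleNr opprK -scalerAr.
by rewrite !mulrA ualphaVK mul1r.
Qed.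

Definition uheis_comul_gen (g : uheis_gen) : tensor U U :=
  match g with
  | GenZ => uz ⊗ 1 + ualpha ⊗ uz
  | GenA => ualpha ⊗ ualpha
  | GenAinv => ualphaV ⊗ ualphaV
  | GenB => ubeta ⊗ 1 + ualpha ⊗ ubeta
  end.

Definition uheis_antipode_gen (g : uheis_gen) : U^c :=
  match g with
  | GenZ => - (ualphaV * uz)
  | GenA => ualphaV
  | GenAinv => ualpha
  | GenB => - (ualphaV * ubeta)
  end.

Lemma uheis_comul_rel s t : uheis_rel lambda s t ->
  peval uheis_comul_gen s = peval uheis_comul_gen t.
Proof.
apply: uheis_relP => {s t} /=.
- by rewrite tpureM ualphaK.
- by rewrite tpureM ualphaVK.
- rewrite !lieDr !lie_pure !(liexx, lie1l, lie1r) ualphabeta.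
  by rewrite !(tpure0l, tpure0r, addr0).
- rewrite !lieDl !lie_pure !(liexx, lie1l, lie1r) uzalpha.
  rewrite !(tpure0l, tpure0r, mul1r, mulr1, addr0, add0r).
  rewrite mulrDr !tpureM mulr1.
  by rewrite !(tpureZl, tpureZr) scalerDr.
- rewrite !(lieDl, lieDr) !lie_pure !(liexx, lie1l, lie1r) ualphabeta.
  rewrite uzalpha uzbeta.
  rewrite !(tpure0l, tpure0r, mul1r, mulr1, addr0, add0r).
  rewrite !(mulrDl, mulrDr) !tpureM !(mul1r, mulr1) -ab.
  rewrite !(tpureZl, tpureZr) !scalerDr -!addrA; congr (_ + _).
  rewrite addrA -scalerDl -opprD -half_double //.
Qed.

Lemma uheis_antipode_rel s t : uheis_rel lambda s t ->
  peval uheis_antipode_gen s = peval uheis_antipode_gen t.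
Proof.
apply: uheis_relP => {s t} /=.
- exact: ualphaK.
- exact: ualphaVK.
- rewrite lie_conv lieNl lieMl liexx mul0r add0r.
  by rewrite /lie a'b subrr mulr0 oppr0.
- have -> : (ualphaV : U^c) * (- (ualphaV * ubeta) : U^c)
          = - (ualphaV * ubeta) * ualphaV :> U by [].
  rewrite lie_conv lieNr lieMr liexx mul0r add0r lie_anti za'.
  by rewrite mulrN opprK mulNr scalerN scaleNr opprK -scalerAr mulrA.
- have -> : (- (ualphaV * ubeta) : U^c) * (- (ualphaV * ubeta) : U^c)
          = ualphaV * ubeta * (ualphaV * ubeta) :> U by exact: mulrNN.
  rewrite lie_conv lieNl lieNr opprK.
  have e : ualphaV * ubeta * (ualphaV * ubeta) =
           ualphaV * (ualphaV * (ubeta * ubeta)).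
    by rewrite -!mulrA [ubeta * (_ * _)]mulrA -a'b !mulrA.
  have e' : lie (ualphaV * ubeta) ualphaV = 0.
    by rewrite lieMl liexx mul0r add0r /lie -a'b subrr mulr0.
  rewrite lieMr e' mul0r add0r lieMl.
  rewrite [lie ualphaV uz]lie_anti za' [lie ubeta uz]lie_anti uzbeta.
  rewrite e scaleNr opprK mulrDr.
  rewrite mulNr mulrN -scalerAl -!scalerAr -(mulrA ubeta).
  rewrite [ualphaV * (ubeta * (ualphaV * _))]mulrA e -scaleNr -scalerDl; congr (_ *: _).
  by rewrite {1}(half_double k0 lambda) opprD subrK.
Qed.

Definition uheis_comul : {lrmorphism U -> tensor U U} :=
  plift (P := P) uheis_comul_rel.
Definition uheis_counit : {lrmorphism U -> k^o} :=
  plift (P := P) (@uheis_counit_rel k lambda).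
Definition uheis_antipode : {lrmorphism U -> U^c} :=
  plift (P := P) uheis_antipode_rel.

Let Dg g : uheis_comul (pgen P g) = uheis_comul_gen g.
Proof. exact: (plift_gen (P := P) uheis_comul_rel g). Qed.
Let Dz : uheis_comul uz = uz ⊗ 1 + ualpha ⊗ uz. Proof. exact: Dg. Qed.
Let Da : uheis_comul ualpha = ualpha ⊗ ualpha. Proof. exact: Dg. Qed.
Let Da' : uheis_comul ualphaV = ualphaV ⊗ ualphaV. Proof. exact: Dg. Qed.
Let Db : uheis_comul ubeta = ubeta ⊗ 1 + ualpha ⊗ ubeta. Proof. exact: Dg. Qed.
Let D1 : uheis_comul 1 = 1 ⊗ 1. Proof. exact: rmorph1. Qed.
Let eg g : uheis_counit (pgen P g) = uheis_counit_gen k g.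
Proof. exact: (plift_gen (P := P) (@uheis_counit_rel k lambda) g). Qed.
Let ez : uheis_counit uz = 0. Proof. exact: eg. Qed.
Let ea : uheis_counit ualpha = 1. Proof. exact: eg. Qed.
Let ea' : uheis_counit ualphaV = 1. Proof. exact: eg. Qed.
Let eb : uheis_counit ubeta = 0. Proof. exact: eg. Qed.
Let e1 : uheis_counit 1 = 1. Proof. exact: rmorph1. Qed.
Let Sg g : uheis_antipode (pgen P g) = uheis_antipode_gen g.
Proof. exact: (plift_gen (P := P) uheis_antipode_rel g). Qed.
Let Sz : uheis_antipode uz = - (ualphaV * uz) :> U. Proof. exact: Sg. Qed.
Let Sa : uheis_antipode ualpha = ualphaV :> U. Proof. exact: Sg. Qed.
Let Sa' : uheis_antipode ualphaV = ualpha :> U. Proof. exact: Sg. Qed.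
Let Sb : uheis_antipode ubeta = - (ualphaV * ubeta) :> U.
Proof. exact: Sg. Qed.
Let S1 : uheis_antipode 1 = 1 :> U. Proof. exact: (rmorph1 uheis_antipode). Qed.

Lemma uheis_comulA (a : U) :
  tassoc (tmap uheis_comul idfun (uheis_comul a)) =
  tmap idfun uheis_comul (uheis_comul a).
Proof.
move: a; apply: presented_comulA; case.
- rewrite Dz !tmapD !tmapE /= Dz Da D1 !(tpureDl, tpureDr) !tassocD !tassocE.
  by rewrite addrA.
- by rewrite Da !tmapE /= Da tassocE.
- by rewrite Da' !tmapE /= Da' tassocE.
- rewrite Db !tmapD !tmapE /= Db Da D1 !(tpureDl, tpureDr) !tassocD !tassocE.
  by rewrite addrA.
Qed.

Lemma uheis_counitl (a : U) :
  tlift (fun b c => (uheis_counit b : k) *: c) (uheis_comul a) = a.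
Proof.
have bal := presented_counitl_balanced uheis_counit.
move: a; apply: presented_counitl; case.
- by rewrite Dz tliftD // !tliftE // ez ea scale0r scale1r add0r.
- by rewrite Da tliftE // ea scale1r.
- by rewrite Da' tliftE // ea' scale1r.
- by rewrite Db tliftD // !tliftE // eb ea scale0r scale1r add0r.
Qed.

Lemma uheis_counitr (a : U) :
  tlift (fun b c => (uheis_counit c : k) *: b) (uheis_comul a) = a.
Proof.
have bal := presented_counitr_balanced uheis_counit.
move: a; apply: presented_counitr; case.
- by rewrite Dz tliftD // !tliftE // ez e1 scale0r scale1r addr0.
- by rewrite Da tliftE // ea scale1r.
- by rewrite Da' tliftE // ea' scale1r.
- by rewrite Db tliftD // !tliftE // eb e1 scale0r scale1r addr0.
Qed.

Lemma uheis_antipodel (a : U) :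
  tlift (fun b c => (uheis_antipode b : U) * c) (uheis_comul a) =
  (uheis_counit a : k)%:A.
Proof.
have bal := presented_antipodel_balanced uheis_antipode.
move: a; apply: presented_antipodel; case.
- by rewrite Dz ez scale0r tliftD // !tliftE // Sz Sa mulr1 addNr.
- by rewrite Da ea scale1r tliftE // Sa ualphaVK.
- by rewrite Da' ea' scale1r tliftE // Sa' ualphaK.
- by rewrite Db eb scale0r tliftD // !tliftE // Sb Sa mulr1 addNr.
Qed.

Lemma uheis_antipoder (a : U) :
  tlift (fun b c => b * (uheis_antipode c : U)) (uheis_comul a) =
  (uheis_counit a : k)%:A.
Proof.
have bal := presented_antipoder_balanced uheis_antipode.
move: a; apply: presented_antipoder; case.
- rewrite Dz ez scale0r tliftD // !tliftE // Sz S1 mulr1.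
  by rewrite mulrN mulrA ualphaK mul1r subrr.
- by rewrite Da ea scale1r tliftE // Sa ualphaK.
- by rewrite Da' ea' scale1r tliftE // Sa' ualphaVK.
- rewrite Db eb scale0r tliftD // !tliftE // Sb S1 mulr1.
  by rewrite mulrN mulrA ualphaK mul1r subrr.
Qed.

Definition uheis_antipode_lin : U -> U := uheis_antipode.
Let antipode_linear : linear uheis_antipode_lin.
Proof. exact: (linearP uheis_antipode). Qed.
HB.instance Definition _ :=
  GRing.isLinear.Build k U U *:%R uheis_antipode_lin antipode_linear.

HB.instance Definition _ := isHopf.Build k U
  uheis_comulA uheis_counitl uheis_counitr
  (uheis_antipodel : forall a, tlift (fun b c => uheis_antipode_lin b * c) _ = _)
  uheis_antipoder.

Lemma comul_uz : comul uz = uz ⊗ 1 + ualpha ⊗ uz. Proof. exact: Dz. Qed.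
Lemma comul_ualpha : comul ualpha = ualpha ⊗ ualpha. Proof. exact: Da. Qed.
Lemma comul_ualphaV : comul ualphaV = ualphaV ⊗ ualphaV. Proof. exact: Da'. Qed.
Lemma comul_ubeta : comul ubeta = ubeta ⊗ 1 + ualpha ⊗ ubeta.
Proof. exact: Db. Qed.
Lemma counit_uz : counit uz = 0. Proof. exact: ez. Qed.
Lemma counit_ualpha : counit ualpha = 1. Proof. exact: ea. Qed.
Lemma counit_ubeta : counit ubeta = 0. Proof. exact: eb. Qed.
Lemma antipode_uz : antipode uz = - (ualphaV * uz). Proof. exact: Sz. Qed.
Lemma antipode_ualpha : antipode ualpha = ualphaV. Proof. exact: Sa. Qed.
Lemma antipode_ubeta : antipode ubeta = - (ualphaV * ubeta).
Proof. exact: Sb. Qed.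

End Uheis.

(* Main.v *)
(** The Heisenberg group is represented by unitriangular matrices: sending
    [alpha], [z], [beta] to [1 + lambda E_01], [E_12], [E_02] is a
    representation of [Uheis], and its coefficients (0,2), (0,1), (1,2) give the
    functionals that [X], [Y], [t] are to induce on [Uheis]. Contracting the
    last leg of the coproduct with them gives three operators, twisted
    derivations of [Uheis] which satisfy the relations of [kHeis]. So [kHeis]
    acts on [Uheis], and the pairing is [<a, x> = counit (a . x)]; its Hopf
    axioms come from [comul (a . x) = (id (x) a .) (comul x)] and
    [a . (x y) = (a_1 . x) (a_2 . y)]. On a monomial [z^m alpha^q beta^r], [Y]
    acts by the scalar [lambda q], [X] lowers [r] and raises [q], and [t] acts
    as [d/dz] up to [alpha], whence the formula. Since both families of ordered
    monomials span, nondegeneracy reduces to the fact that a polynomial is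
    determined by its values at the pairwise distinct points [lambda q].       *)

From HB Require Import structures.
Require Import Defs.
From mathcomp Require Import all_boot all_algebra ring.

Set Implicit Arguments.
Unset Strict Implicit.
Unset Printing Implicit Defensive.

Import GRing.Theory.
Local Open Scope ring_scope.

(** * Modules over a presented algebra, given by operators that satisfy the relations *)

Section PresentedModule.
Variables (k : fieldType) (P : presentation k) (V : lmodType k).
Variable f : pgens P -> {linear V -> V}.

(** Terms are interpreted directly as operators, with composition as product, so the endomorphisms
    of [V] do not have to be packaged as an [algType]. *)
Fixpoint term_act (s : pterm k (pgens P)) (v : V) : V :=
  match s with
  | PConst c => c *: v
  | PGen g => f g v
  | PAdd s t => term_act s v + term_act t v
  | PMul s t => term_act s (term_act t v)
  end.

Lemma term_act_linear s : linear (term_act s).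
Proof.
elim: s => [c|g|s IHs t IHt|s IHs t IHt] a u v /=.
- by rewrite scalerDr !scalerA mulrC.
- exact: linearP.
- by rewrite IHs IHt scalerDr addrACA.
- by rewrite IHt IHs.
Qed.

Let act0 s : term_act s 0 = 0.
Proof. by have := term_act_linear s (-1) 0 0; rewrite scaler0 addr0 scaleN1r addNr. Qed.
Let actD s u v : term_act s (u + v) = term_act s u + term_act s v.
Proof. by have := term_act_linear s 1 u v; rewrite !scale1r. Qed.
Let actZ s c v : term_act s (c *: v) = c *: term_act s v.
Proof. by have := term_act_linear s c v 0; rewrite act0 !addr0. Qed.

Hypothesis frel : forall s t, prel s t -> term_act s =1 term_act t.

(** Each clause of the congruence is an identity between operators. Linearity of [term_act] enters
    for right distributivity and for the centrality of constants. *)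
Lemma term_act_cong s t : pcong (@prel k P) s t -> term_act s =1 term_act t.
Proof.
elim=> {s t} //=.
- by move=> s t _ st v; rewrite st.
- by move=> t s u _ st _ tu v; rewrite st.
- by move=> s s' t t' _ ss' _ tt' v /=; rewrite ss' tt'.
- by move=> s s' t t' _ ss' _ tt' v /=; rewrite tt' ss'.
- by move=> s t u v /=; rewrite addrA.
- by move=> s t v /=; rewrite addrC.
- by move=> s v /=; rewrite scale0r add0r.
- by move=> s v /=; rewrite scaleN1r addNr scale0r.
- by move=> s v /=; rewrite scale1r.
- by move=> s v /=; rewrite scale1r.
- by move=> s t u v /=; rewrite actD.
- by move=> c d v /=; rewrite scalerDl.
- by move=> c d v /=; rewrite scalerA.
- by move=> c s v /=; rewrite actZ.
Qed.

Definition pact of (forall s t, prel s t -> term_act s =1 term_act t) :=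
  fun (a : presented P) (v : V) => term_act (repr a) v.
Local Notation act := (pact frel).

Let actE s v : act (pclass s) v = term_act s v.
Proof. exact/term_act_cong/reprP. Qed.

Lemma pact_is_linear a : linear (act a).
Proof. exact: term_act_linear. Qed.
HB.instance Definition _ a :=
  GRing.isLinear.Build k V V *:%R (act a) (pact_is_linear a).

Lemma pact_gen g v : act (pgen P g) v = f g v.
Proof. exact: actE. Qed.

Lemma pactDl a b v : act (a + b) v = act a v + act b v.
Proof. by rewrite -[a]pclassK -[b]pclassK -pclassD !actE. Qed.

Lemma pactM a b v : act (a * b) v = act a (act b v).
Proof. by rewrite -[a]pclassK -[b]pclassK -pclassM !actE. Qed.

Lemma pactC c v : act c%:A v = c *: v.
Proof. by rewrite -pclassC actE. Qed.

Lemma pact1 v : act 1 v = v.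
Proof. by rewrite -[X in act X](scale1r 1) pactC scale1r. Qed.

Lemma pactZl c a v : act (c *: a) v = c *: act a v.
Proof. by rewrite -[X in c *: X]mul1r scalerAl pactM pactC. Qed.

End PresentedModule.

(** * Contraction of the last leg of the coproduct with a functional *)

Section Contraction.
Variables (k : fieldType) (K : hopfType k).

(** The left coregular action [x_(1) f(x_(2))] of the functional [f] on [K]. *)
Definition contract (f : K -> k) (x : K) : K :=
  tlift (fun a b => f b *: a) (comul x).

Lemma contract_balanced (f : {scalar K}) : balanced (fun a b : K => f b *: a).
Proof.
split=> [b a a'|a b b'|c a b]; rewrite ?linearD ?scalerDl ?scalerDr //.
by rewrite scalerA [f (c *: b)]linearZ mulrC.
Qed.
Local Hint Resolve contract_balanced : core.

Lemma contract_is_linear (f : {scalar K}) : linear (contract f).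
Proof.
move=> c x y; rewrite /contract linearP tliftD // tliftZ // => d a b.
by rewrite !scalerA mulrC.
Qed.
HB.instance Definition _ (f : {scalar K}) :=
  GRing.isLinear.Build k K K *:%R (contract f) (contract_is_linear f).

(* Both sides contract the last leg of [x_1 (x) x_2 (x) x_3]. *)
Lemma comul_contract (f : {scalar K}) x :
  comul (contract f x) = tmap idfun (contract f) (comul x).
Proof.
pose last (w : tensor K K) := tlift (fun a b => f b *: a) w.
pose G := tlift (fun a w => a ⊗ last w) : tensor K (tensor K K) -> tensor K K.
have bG : balanced (fun a w => a ⊗ last w).
  split=> [b a a'|a b b'|c a b]; rewrite ?tpureDl //.
    by rewrite /last tliftD // tpureDr.
  rewrite /last tliftZ // ?tpureZl ?tpureZr // => d a' b'.
  by rewrite !scalerA mulrC.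
have bc := tmap_balanced (comul : {lrmorphism K -> tensor K K}) (idfun : {linear K -> K}).
have bc' := tmap_balanced (idfun : {linear K -> K}) (comul : {lrmorphism K -> tensor K K}).
have bi := tmap_balanced (idfun : {linear K -> K}) (contract f : {linear K -> K}).
transitivity (G (tassoc (tmap comul idfun (comul x)))).
  rewrite {1}/contract; elim/tensor_ind: (comul x) => [|a b|u v IHu IHv].
  - by rewrite /tmap !tlift0 // linear0 tassoc0 /G tlift0.
  - rewrite tliftE // linearZ /= tmapE /=.
    elim/tensor_ind: (comul a) => [|c d|u v IHu IHv].
    + by rewrite scaler0 tpure0l tassoc0 /G tlift0.
    + by rewrite tassocE /G tliftE // /last tliftE // tpureZr.
    + by rewrite scalerDr tpureDl tassocD IHu IHv /G tliftD.
  - by rewrite tliftD // linearD /= IHu IHv tmapD tassocD /G tliftD.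
rewrite comulA; elim/tensor_ind: (comul x) => [|a b|u v IHu IHv].
- by rewrite /tmap !tlift0 // /G tlift0.
- by rewrite !tmapE /G tliftE.
- by rewrite !tmapD -IHu -IHv /G tliftD.
Qed.

Section Coefficients.
Variables (n : nat) (rho : {lrmorphism K -> 'M[k]_n.+1}).

Definition mxcoef i j (x : K) : k := rho x i j.

Lemma mxcoef_is_linear i j : scalar (mxcoef i j).
Proof. by move=> c x y; rewrite /mxcoef linearP !mxE. Qed.
HB.instance Definition _ i j :=
  GRing.isLinear.Build k K k *%R (mxcoef i j) (mxcoef_is_linear i j).

Lemma mxcoefM i j x y :
  mxcoef i j (x * y) = \sum_l mxcoef i l x * mxcoef l j y.
Proof. by rewrite /mxcoef rmorphM mxE. Qed.

(** The coproduct is multiplicative and [rho] turns products into matrix products, so coefficients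
    of a representation obey a Leibniz rule indexed by the middle index [l]. *)
Lemma contract_mul i j x y :
  contract (mxcoef i j) (x * y) =
  \sum_l contract (mxcoef i l) x * contract (mxcoef l j) y.
Proof.
rewrite /contract rmorphM /=.
elim/tensor_ind: (comul x) => [|a b|u v IHu IHv].
- by rewrite mul0r tlift0 // big1 // => l _; rewrite tlift0 ?mul0r.
- elim/tensor_ind: (comul y) => [|a' b'|u v IHu IHv].
  + by rewrite mulr0 tlift0 // big1 // => l _; rewrite [X in _ * X]tlift0 ?mulr0.
  + rewrite tpureM tliftE // mxcoefM scaler_suml.
    apply: eq_bigr => l _; rewrite !(tliftE (contract_balanced _)).
    by rewrite -scalerAl -scalerAr scalerA.
  + rewrite mulrDr tliftD // IHu IHv -big_split; apply: eq_bigr => l _.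
    by rewrite [in RHS](tliftD (contract_balanced _)) // mulrDr.
- rewrite mulrDl tliftD // IHu IHv -big_split; apply: eq_bigr => l _.
  by rewrite [in RHS](tliftD (contract_balanced _)) // mulrDl.
Qed.

End Coefficients.
End Contraction.

(** * The action of [kHeis] on [Uheis] by twisted derivations *)

Section HeisAction.
Variables (k : fieldType) (k0 : [pchar k] =i pred0) (lambda : k).
Local Notation H := (kHeis k0 lambda).
Local Notation U := (Uheis k0 lambda).
Local Notation z := (uz k0 lambda).
Local Notation alpha := (ualpha k0 lambda).
Local Notation alphaV := (ualphaV k0 lambda).
Local Notation beta := (ubeta k0 lambda).
Local Notation X := (hX k0 lambda).
Local Notation Y := (hY k0 lambda).
Local Notation t := (ht k0 lambda).
Local Notation E i j := (delta_mx i j : 'M[k]_3).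

Definition uheis_mx_gen (g : uheis_gen) : 'M[k]_3 :=
  match g with
  | GenZ => E 1 2
  | GenA => 1 + lambda *: E 0 1
  | GenAinv => 1 - lambda *: E 0 1
  | GenB => E 0 2
  end.

Let EM (i j i' j' : 'I_3) : E i j * E i' j' = E i j' *+ (j == i').
Proof. exact: mul_delta_mx_cond. Qed.

(** [E_01] squares to zero, which gives the inverse of [alpha]. The only nonzero commutator is
    [[E_12, lambda E_01] = - lambda E_02], and [alpha * beta] is again [E_02]; both sides of the
    relation for [z] and [beta] vanish. *)
Lemma uheis_mx_rel s u : uheis_rel lambda s u ->
  peval uheis_mx_gen s = peval uheis_mx_gen u.
Proof.
have NN : lambda *: E 0 1 * (lambda *: E 0 1) = 0.
  by rewrite -scalerAl -scalerAr EM mulr0n !scaler0.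
apply: uheis_relP => {s u} /=.
- by rewrite mulrDl mul1r mulrBr mulr1 NN subr0 subrK.
- by rewrite mulrBl mul1r mulrDr mulr1 NN addr0 addrK.
- by rewrite lieDl lie1l /lie -scalerAl -scalerAr !EM !mulr0n !scaler0 subr0 addr0.
- rewrite lieDr lie1r /lie mulrDl -!scalerAl -scalerAr !EM mulr0n mul1r.
  by rewrite !scaler0 sub0r add0r addr0 scaleNr mulr1n.
- by rewrite /lie !EM /= !mulr0n subr0 scaler0.
Qed.

Definition uheis_mx : {lrmorphism U -> 'M[k]_3} :=
  plift (P := uheis_presentation lambda) uheis_mx_rel.

Let mx_gen g : uheis_mx (pgen _ g) = uheis_mx_gen g.
Proof. exact: (plift_gen (P := uheis_presentation lambda) uheis_mx_rel g). Qed.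

Local Notation rho := (mxcoef uheis_mx).

Let counit_gen g : counit (pgen (uheis_presentation lambda) g : U) =
  uheis_counit_gen k g.
Proof. exact: (plift_gen (P := uheis_presentation lambda) (@uheis_counit_rel k lambda) g). Qed.

(** Generators are sent to upper triangular matrices with their counit on the diagonal, and sums and
    products preserve this because the counit is multiplicative. In [contract_mul] it makes the
    diagonal contractions trivial and the lower ones zero. *)
Lemma uheis_mx_trig (x : U) (i j : 'I_3) :
  (j <= i)%N -> rho i j x = (counit x : k) *+ (i == j).
Proof.
move: x i j; apply: presented_ind.
- move=> c i j _; rewrite /mxcoef linearZ rmorph1 /= !mxE linearZ rmorph1 /=.
  by rewrite mulrnAr.
- move=> g i j ji; rewrite /mxcoef mx_gen counit_gen.
  by case: g; case: i ji => [[|[|[|]]] ?] //=; case: j => [[|[|[|]]] ?] //= _;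
    rewrite !mxE /= ?(mulr0, addr0, subr0).
- move=> x y IHx IHy i j ji; have := IHx i j ji; have := IHy i j ji.
  by rewrite /mxcoef linearD mxE => -> ->; rewrite linearD mulrnDl.
- move=> x y IHx IHy i j ji; rewrite /mxcoef !rmorphM mxE.
  have [ij|neq] := eqVneq i j.
    subst j; rewrite (bigD1 i) //= big1 ?addr0.
      have := IHx i i (leqnn _); have := IHy i i (leqnn _).
      by rewrite /mxcoef eqxx => -> ->; rewrite mulr1n.
    (* For [l] different from [i], one of the two factors sits strictly below the diagonal. *)
    move=> l li; have [il|il] := leqP i l.
      by have := IHy l i il; rewrite /mxcoef (negPf li) => ->; rewrite mulr0.
    have := IHx i l (ltnW il); rewrite /mxcoef eq_sym (negPf li) => ->.
    by rewrite mul0r.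
  (* Since [j < i], no [l] satisfies both [i <= l] and [l <= j]: one factor is always strictly below
     the diagonal. *)
  apply: big1 => l _; have [il|il] := leqP i l.
    have jl : (j < l)%N by rewrite (leq_trans _ il) // ltn_neqAle ji eq_sym neq.
    have := IHy l j (ltnW jl); rewrite /mxcoef => ->.
    by rewrite (_ : l == j = false) ?mulr0 //; apply/eqP => lj; rewrite lj ltnn in jl.
  have := IHx i l (ltnW il); rewrite /mxcoef => ->.
  by rewrite (_ : i == l = false) ?mul0r //; apply/eqP => lj; rewrite lj ltnn in il.
Qed.

Definition heis_act_gen (g : heis_gen) : {linear U -> U} :=
  match g with
  | GenX => contract (rho 0 2)
  | GenY => contract (rho 0 1)
  | GenT => contract (rho 1 2)
  end.

Local Notation DX := (heis_act_gen GenX).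
Local Notation DY := (heis_act_gen GenY).
Local Notation DT := (heis_act_gen GenT).

Let contract_diag i x : contract (rho i i) x = x.
Proof.
rewrite -[RHS]counitr; apply: eq_tlift => a b.
by rewrite uheis_mx_trig // eqxx.
Qed.

Let contract_low (i j : 'I_3) x : (j < i)%N -> contract (rho i j) x = 0.
Proof.
move=> ji; rewrite /contract /tlift big1 // => p _.
rewrite uheis_mx_trig 1?ltnW // (_ : i == j = false) ?scale0r //.
by apply/eqP => ij; rewrite ij ltnn in ji.
Qed.

Let ord3 (F : 'I_3 -> U) : \sum_l F l = F 0 + F 1 + F 2.
Proof.
rewrite !big_ord_recl big_ord0 addr0 addrA.
by congr (F _ + F _ + F _); exact: val_inj.
Qed.

(** Of the three middle indices only those between row and column survive. For the adjacent indices
    0 and 1 these are the two ends, whose diagonal factors act trivially: an ordinary derivation. *)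
Lemma heis_act_YM x y : DY (x * y) = DY x * y + x * DY y.
Proof.
by rewrite /= contract_mul ord3 !contract_diag [contract (rho 2 1) y]contract_low // mulr0 addr0 addrC.
Qed.

Lemma heis_act_tM x y : DT (x * y) = DT x * y + x * DT y.
Proof.
by rewrite /= contract_mul ord3 !contract_diag [contract (rho 1 0) x]contract_low // mul0r add0r addrC.
Qed.

(** Between 0 and 2 the middle index 1 survives as well; its contribution is the counterpart of the
    summand [Y (x) t] in the coproduct of [X]. *)
Lemma heis_act_XM x y : DX (x * y) = DX x * y + x * DX y + DY x * DT y.
Proof.
by rewrite /= contract_mul ord3 !contract_diag addrC addrA.
Qed.

Let rho1 i j : rho i j 1 = (i == j)%:R.
Proof. by rewrite /mxcoef rmorph1 mxE. Qed.

Let DgE g : exists i j, i != j /\ heis_act_gen g = contract (rho i j) :> (U -> U).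
Proof. by case: g; [exists 0, 2|exists 0, 1|exists 1, 2]. Qed.

Lemma heis_act_gen1 g : heis_act_gen g 1 = 0.
Proof.
have [i [j [ij ->]]] := DgE g; rewrite /contract rmorph1 -tpure1.
by rewrite (tliftE (contract_balanced _)) /= rho1 (negPf ij) scale0r.
Qed.

Let Dz i j : contract (rho i j) z = (i == j)%:R *: z + uheis_mx_gen GenZ i j *: alpha.
Proof.
rewrite /contract comul_uz (tliftD (contract_balanced _)).
by rewrite !(tliftE (contract_balanced _)) /= rho1 /mxcoef mx_gen.
Qed.
Let Dbeta i j :
  contract (rho i j) beta = (i == j)%:R *: beta + uheis_mx_gen GenB i j *: alpha.
Proof.
rewrite /contract comul_ubeta (tliftD (contract_balanced _)).
by rewrite !(tliftE (contract_balanced _)) /= rho1 /mxcoef mx_gen.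
Qed.
Let Dalpha i j : contract (rho i j) alpha = uheis_mx_gen GenA i j *: alpha.
Proof.
by rewrite /contract comul_ualpha (tliftE (contract_balanced _)) /= /mxcoef mx_gen.
Qed.
Let DalphaV i j : contract (rho i j) alphaV = uheis_mx_gen GenAinv i j *: alphaV.
Proof.
by rewrite /contract comul_ualphaV (tliftE (contract_balanced _)) /= /mxcoef mx_gen.
Qed.

Definition heis_act_table (g : heis_gen) (x : uheis_gen) : U :=
  match g, x with
  | GenX, GenB => alpha
  | GenY, GenA => lambda *: alpha
  | GenY, GenAinv => - lambda *: alphaV
  | GenT, GenZ => alpha
  | _, _ => 0
  end.

Lemma heis_act_gen_table g x :
  heis_act_gen g (pgen (uheis_presentation lambda) x) = heis_act_table g x.
Proof.
case: x; case: g; rewrite /= (Dz, Dalpha, DalphaV, Dbeta) !mxE /=;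
  rewrite ?(mulr0, mulr1, addr0, add0r, subr0, sub0r, oppr0) ?(scale0r, scale1r, addr0, add0r) //.
Qed.

Let Dg0 g : heis_act_gen g 0 = 0. Proof. exact: linear0. Qed.
Let DgD g x y : heis_act_gen g (x + y) = heis_act_gen g x + heis_act_gen g y.
Proof. exact: linearD. Qed.
Let DgZ g c x : heis_act_gen g (c *: x) = c *: heis_act_gen g x.
Proof. exact: linearZZ. Qed.
Let tabz g : heis_act_gen g z = heis_act_table g GenZ.
Proof. exact: heis_act_gen_table. Qed.
Let tabalpha g : heis_act_gen g alpha = heis_act_table g GenA.
Proof. exact: heis_act_gen_table. Qed.
Let tabalphaV g : heis_act_gen g alphaV = heis_act_table g GenAinv.
Proof. exact: heis_act_gen_table. Qed.
Let tabbeta g : heis_act_gen g beta = heis_act_table g GenB.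
Proof. exact: heis_act_gen_table. Qed.

Local Notation tabE := (tabz, tabalpha, tabalphaV, tabbeta, DgZ, Dg0, scaler0).

Local Notation opM := (heis_act_XM, heis_act_YM, heis_act_tM, DgD).

(** Multiplication in [Uheis] is not commutative, so after expansion the summands are matched one by
    one up to commutativity of addition alone. *)
Local Ltac reorder_sum :=
  rewrite ?(mulrDl, mulrDr) -?(scalerAl, scalerAr) -?addrA;
  repeat match goal with
  | |- ?a + _ = ?r => rewrite ?[in RHS](addrCA _ a) ?[in RHS](addrC _ a);
                      apply: (congr1 (+%R a))
  end.

(** The commutator of two derivations is a derivation, so the relation need only be checked on
    generators, where the table decides it. The same induction serves for the other two relations,
    with corrections from the twisted rule of [X]. *)
Lemma heis_act_Yt x : DY (DT x) = DT (DY x) + lambda *: DT x.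
Proof.
elim/presented_ind: x => [c|g|x y IHx IHy|x y IHx IHy].
- by rewrite !DgZ !heis_act_gen1 !Dg0 !scaler0 addr0.
- by case: g; rewrite !heis_act_gen_table /heis_act_table;
    do ![rewrite !tabE /heis_act_table]; rewrite ?addr0 ?add0r.
- by rewrite !DgD IHx IHy scalerDr; reorder_sum.
- by rewrite !opM IHx IHy scalerDr; reorder_sum.
Qed.

(** On a product, the twist [DY x * DT y] in the rule for [X] brings in the commutator of [Y] and
    [t]. *)
Lemma heis_act_YX x : DY (DX x) = DX (DY x) + lambda *: DX x.
Proof.
elim/presented_ind: x => [c|g|x y IHx IHy|x y IHx IHy].
- by rewrite !DgZ !heis_act_gen1 !Dg0 !scaler0 addr0.
- by case: g; rewrite !heis_act_gen_table /heis_act_table;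
    do ![rewrite !tabE /heis_act_table]; rewrite ?addr0 ?add0r.
- by rewrite !DgD IHx IHy scalerDr; reorder_sum.
- by rewrite !opM IHx IHy heis_act_Yt !scalerDr; reorder_sum.
Qed.

Lemma heis_act_Xt x : DX (DT x) = DT (DX x) + (lambda / 2) *: DT (DT x).
Proof.
elim/presented_ind: x => [c|g|x y IHx IHy|x y IHx IHy].
- by rewrite !DgZ !heis_act_gen1 !Dg0 !scaler0 addr0.
- by case: g; rewrite !heis_act_gen_table /heis_act_table;
    do ![rewrite !tabE /heis_act_table]; rewrite ?addr0 ?add0r.
- by rewrite !DgD IHx IHy scalerDr; reorder_sum.
(* The twist leaves [lambda *: (DT x * DT y)], while [DT (DT (x * y))] contains [DT x * DT y] twice
   with coefficient [lambda / 2]; splitting [lambda] into halves lets the summands match. *)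
- have Yt : DY (DT x) = DT (DY x) + ((lambda / 2) *: DT x + (lambda / 2) *: DT x).
    by rewrite heis_act_Yt -scalerDl -Defs.half_double.
  by rewrite !opM IHx IHy Yt !scalerDr; reorder_sum.
Qed.

Lemma heis_act_rel s u : heis_rel lambda s u ->
  term_act (P := heis_presentation lambda) heis_act_gen s =1
  term_act (P := heis_presentation lambda) heis_act_gen u.
Proof.
by case=> x; apply/eqP; rewrite /= scaleN1r subr_eq addrC;
  apply/eqP; [exact: heis_act_YX|exact: heis_act_Xt|exact: heis_act_Yt].
Qed.

Definition heis_act : H -> U -> U := pact (P := heis_presentation lambda) heis_act_rel.
HB.instance Definition _ a := GRing.Linear.on (heis_act a).

Lemma heis_act_gE g x : heis_act (pgen (heis_presentation lambda) g) x = heis_act_gen g x.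
Proof. exact: (pact_gen (P := heis_presentation lambda)). Qed.
Lemma heis_actD a b x : heis_act (a + b) x = heis_act a x + heis_act b x.
Proof. exact: pactDl. Qed.
Lemma heis_actM a b x : heis_act (a * b) x = heis_act a (heis_act b x).
Proof. exact: pactM. Qed.
Lemma heis_actZ c a x : heis_act (c *: a) x = c *: heis_act a x.
Proof. exact: pactZl. Qed.
Lemma heis_act1 x : heis_act 1 x = x.
Proof. exact: pact1. Qed.

End HeisAction.

(** * Tensor maps as functions of their second factor *)

Lemma tmap0 (k : fieldType) (A B A' B' : lmodType k)
  (f : {linear A -> A'}) (g : {linear B -> B'}) : tmap f g 0 = 0.
Proof. exact/tlift0/tmap_balanced. Qed.

Section TensorMaps.
Variables (k : fieldType) (A B C : lmodType k).
Implicit Types u : tensor A B.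

(** The hypotheses here and in the next two lemmas are pointwise because the operator of [a + b] or
    [a * b] is known to be a sum or a composite only pointwise. *)
Lemma tmap_addr (f g h : {linear B -> C}) u :
  (forall b, h b = f b + g b) ->
  tmap (@idfun A) h u = tmap (@idfun A) f u + tmap (@idfun A) g u.
Proof.
move=> hE; elim/tensor_ind: u => [|a b|u v IHu IHv]; first by rewrite !tmap0 addr0.
  by rewrite !tmapE hE tpureDr.
by rewrite !tmapD addrACA IHu IHv.
Qed.

Lemma tmap_scaler (f : {linear B -> B}) c u :
  (forall b, f b = c *: b) -> tmap (@idfun A) f u = c *: u.
Proof.
move=> fE; elim/tensor_ind: u => [|a b|u v IHu IHv]; first by rewrite tmap0 scaler0.
  by rewrite tmapE /= fE tpureZr.
by rewrite tmapD scalerDr IHu IHv.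
Qed.

Lemma tmap_compr (D : lmodType k)
    (f : {linear C -> D}) (g : {linear B -> C}) (h : {linear B -> D}) u :
  (forall b, h b = f (g b)) ->
  tmap (@idfun A) h u = tmap (@idfun A) f (tmap (@idfun A) g u).
Proof.
move=> hE; elim/tensor_ind: u => [|a b|u v IHu IHv]; first by rewrite !tmap0.
  by rewrite !tmapE hE.
by rewrite !tmapD IHu IHv.
Qed.

End TensorMaps.

(** * The pairing and its compatibility with products and coproducts *)

Section HeisPairing.
Variables (k : fieldType) (k0 : [pchar k] =i pred0) (lambda : k).
Local Notation H := (kHeis k0 lambda).
Local Notation U := (Uheis k0 lambda).
Local Notation X := (hX k0 lambda).
Local Notation Y := (hY k0 lambda).
Local Notation t := (ht k0 lambda).
Local Notation act := (@heis_act k k0 lambda).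

Definition heis_pairing (a : H) (x : U) : k := counit (act a x).

Lemma heis_pairing_bilinear : bilinear_for *%R *%R heis_pairing.
Proof.
split=> [x c a b|a c x y]; rewrite /heis_pairing.
  by rewrite heis_actD heis_actZ linearP.
by rewrite !linearP.
Qed.
HB.instance Definition _ :=
  bilinear_isBilinear.Build k H U k *%R *%R heis_pairing heis_pairing_bilinear.
HB.instance Definition _ a :=
  GRing.isLinear.Build k U k *%R (heis_pairing a) (heis_pairing_bilinear.2 a).
Local Notation p := heis_pairing.

(** Generators act by contractions, which touch only the last leg of the coproduct, and sums and
    composites of such operators do so too. *)
Lemma comul_heis_act a x : comul (act a x) = tmap idfun (act a) (comul x).
Proof.
elim/presented_ind: a x => [c|g|a b IHa IHb|a b IHa IHb] x.
- have actc y : act c%:A y = c *: y by rewrite heis_actZ heis_act1.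
  by rewrite (tmap_scaler _ actc) actc; exact: linearZZ.
- rewrite heis_act_gE; transitivity (tmap idfun (heis_act_gen k0 lambda g) (comul x)).
    by case: g; exact: comul_contract.
  by apply: eq_tlift => y y'; rewrite heis_act_gE.
- have comulD (y y' : U) : comul (y + y') = comul y + comul y' by exact: linearD.
  rewrite heis_actD comulD IHa IHb.
  by rewrite (tmap_addr _ (heis_actD a b)).
- rewrite heis_actM IHa IHb.
  by rewrite (tmap_compr _ (heis_actM a b)).
Qed.

(** Applying the counit to the second leg of [comul_heis_act] recovers the operator of [b] from its
    functional. Evaluating the functional of [a] on this contraction then gives the rule for
    [p (a * b)]. *)
Lemma heis_act_contract b x : act b x = contract (p b) x.
Proof.
have balb := contract_balanced (p b : {scalar U}).
have bal := contract_balanced (counit : {scalar U}).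
rewrite -[LHS]counitr comul_heis_act /contract.
elim/tensor_ind: (comul x) => [|y y'|u v IHu IHv].
- by rewrite tmap0 !tlift0.
- by rewrite tmapE !tliftE.
- by rewrite tmapD !tliftD // IHu IHv.
Qed.

Lemma heis_pairing_mull a b x :
  p (a * b) x = tlift (fun x1 x2 => p a x1 * p b x2) (comul x).
Proof.
rewrite {1}/heis_pairing heis_actM -/(p _ _) heis_act_contract /contract /tlift.
by rewrite linear_sumr; apply: eq_bigr => y _; rewrite linearZr_LR mulrC.
Qed.

Lemma act_mul_balanced x y : balanced (fun a1 a2 => act a1 x * act a2 y).
Proof.
split=> [b a a'|a b b'|c a b]; rewrite ?heis_actD ?mulrDl ?mulrDr //.
by rewrite !heis_actZ -scalerAl -scalerAr.
Qed.

(** [Uheis] is a module algebra: the Leibniz rules of the generators are read off their coproducts,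
    and multiplicativity of the coproduct extends this to all of [kHeis]. *)
Lemma heis_act_mul a x y :
  act a (x * y) = tlift (fun a1 a2 => act a1 x * act a2 y) (comul a).
Proof.
have bal := act_mul_balanced.
elim/presented_ind: a x y => [c|g|a b IHa IHb|a b IHa IHb] x y.
- rewrite heis_actZ heis_act1 linearZZ rmorph1 -tpure1 -tpureZl tliftE //.
  by rewrite heis_actZ !heis_act1 -scalerAl.
- case: g.
  + rewrite -[pgen _ _]/X comul_hX !tliftD // !tliftE // !heis_act1 !heis_act_gE.
    exact: heis_act_XM.
  + rewrite -[pgen _ _]/Y comul_hY !tliftD // !tliftE // !heis_act1 !heis_act_gE.
    exact: heis_act_YM.
  + rewrite -[pgen _ _]/t comul_ht !tliftD // !tliftE // !heis_act1 !heis_act_gE.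
    exact: heis_act_tM.
- by rewrite heis_actD linearD tliftD // IHa IHb.
- pose F x' y' (u : tensor H H) := tlift (fun a1 a2 => act a1 x' * act a2 y') u.
  (* Right multiplication by [b1 (x) b2] lets [b1] and [b2] act first, so acting with [a] after [b]
     corresponds to multiplying their coproducts. *)
  have FM u b1 b2 : F x y (u * (b1 ⊗ b2)) = F (act b1 x) (act b2 y) u.
    rewrite /F; elim/tensor_ind: u => [|a1 a2|u v IHu IHv].
    - by rewrite mul0r !tlift0.
    - by rewrite tpureM !tliftE // !heis_actM.
    - by rewrite mulrDl !tliftD // IHu IHv.
  have FC v : act a (F x y v) = F x y (comul (a : H) * v).
    elim/tensor_ind: v => [|b1 b2|u v IHu IHv].
    - by rewrite mulr0 /F !tlift0 // linear0.
    - by rewrite FM {1}/F tliftE // IHa.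
    - by rewrite mulrDr /F !tliftD // -!/(F _ _ _) -IHu -IHv; exact: linearD.
  by rewrite heis_actM IHb [LHS]FC rmorphM.
Qed.

Lemma heis_pairing_mulr a x y :
  p a (x * y) = tlift (fun a1 a2 => p a1 x * p a2 y) (comul a).
Proof.
rewrite /heis_pairing heis_act_mul /tlift linear_sum.
by apply: eq_bigr => b _; rewrite rmorphM.
Qed.

End HeisPairing.

(** * Units and counits under the pairing *)

Section HeisHopfPairing.
Variables (k : fieldType) (k0 : [pchar k] =i pred0) (lambda : k).
Local Notation X := (hX k0 lambda).
Local Notation Y := (hY k0 lambda).
Local Notation t := (ht k0 lambda).
Local Notation act := (@heis_act k k0 lambda).
Local Notation p := (@heis_pairing k k0 lambda).

Lemma heis_pairing_1l x : p 1 x = counit x.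
Proof. by rewrite /heis_pairing heis_act1. Qed.

Lemma heis_actZr a c x : act a (c *: x) = c *: act a x.
Proof. exact: linearZZ. Qed.

Lemma heis_actDr a x y : act a (x + y) = act a x + act a y.
Proof. exact: linearD. Qed.

Lemma heis_act_1r a : act a 1 = (counit a : k)%:A.
Proof.
elim/presented_ind: a => [c|g|a b IHa IHb|a b IHa IHb].
- rewrite heis_actZ heis_act1; congr (_ *: _).
  by rewrite linearZZ rmorph1; exact/esym/mulr1.
- rewrite heis_act_gE heis_act_gen1; case: g.
  + by rewrite -[pgen _ _]/X counit_hX scale0r.
  + by rewrite -[pgen _ _]/Y counit_hY scale0r.
  + by rewrite -[pgen _ _]/t counit_ht scale0r.
- by rewrite heis_actD linearD scalerDl IHa IHb.
- by rewrite heis_actM IHb heis_actZr IHa rmorphM scalerA mulrC.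
Qed.

Lemma heis_pairing_1r a : p a 1 = counit a.
Proof. by rewrite /heis_pairing heis_act_1r linearZZ rmorph1; exact: mulr1. Qed.

Lemma heis_actX x : act X x = heis_act_gen k0 lambda GenX x. Proof. exact: heis_act_gE. Qed.
Lemma heis_actY x : act Y x = heis_act_gen k0 lambda GenY x. Proof. exact: heis_act_gE. Qed.
Lemma heis_actt x : act t x = heis_act_gen k0 lambda GenT x. Proof. exact: heis_act_gE. Qed.

Lemma heis_act_gen_pgen g u :
  act (pgen (heis_presentation lambda) g) (pgen (uheis_presentation lambda) u)
  = heis_act_table k0 lambda g u.
Proof. by rewrite heis_act_gE heis_act_gen_table. Qed.

End HeisHopfPairing.

(** * Compatibility of the pairing with the antipodes *)

Section FlippedAntimorphism.
Variables (k : fieldType) (A : algType k) (S : {linear A -> A}).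
Hypothesis SM : forall x y, S (x * y) = S y * S x.

Definition tflip (a b : A) : tensor A A := S b ⊗ S a.

Lemma tflip_balanced : balanced tflip.
Proof.
split=> [b a a'|a b b'|c a b]; rewrite /tflip ?linearD ?tpureDl ?tpureDr //.
by rewrite !linearZZ tpureZl tpureZr.
Qed.
Local Hint Resolve tflip_balanced : core.

(** The flip is multiplicative and [S] reverses products in each leg. This makes it possible to
    compare [tflip] after [comul] with [comul] after the antipode on generators only. *)
Lemma tflipM u v : tlift tflip (u * v) = tlift tflip v * tlift tflip u.
Proof.
elim/tensor_ind: u => [|a b|u u' IHu IHu'].
- by rewrite mul0r tlift0 // mulr0.
- elim/tensor_ind: v => [|a' b'|v v' IHv IHv'].
  + by rewrite mulr0 tlift0 // mul0r.
  + by rewrite tpureM !tliftE // /tflip !SM tpureM.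
  + by rewrite mulrDr !tliftD // mulrDl IHv IHv'.
- by rewrite mulrDl !tliftD // mulrDr IHu IHu'.
Qed.

End FlippedAntimorphism.

Section HeisPairingAntipode.
(* Distinct generators are terms of the same quotient: unless they are opaque,
   a failed match between two of them unfolds the whole quotient.             *)
#[local] Opaque pgen.
Variables (k : fieldType) (k0 : [pchar k] =i pred0) (lambda : k).
Local Notation H := (kHeis k0 lambda).
Local Notation U := (Uheis k0 lambda).
Local Notation z := (uz k0 lambda).
Local Notation alpha := (ualpha k0 lambda).
Local Notation alphaV := (ualphaV k0 lambda).
Local Notation beta := (ubeta k0 lambda).
Local Notation X := (hX k0 lambda).
Local Notation Y := (hY k0 lambda).
Local Notation t := (ht k0 lambda).
Local Notation p := (@heis_pairing k k0 lambda).
Local Notation values_on_gens := (@heis_act_gen_pgen k k0 lambda).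

Lemma uheis_antipodeM (x y : U) : antipode (x * y) = antipode y * antipode x.
Proof. exact: (rmorphM (uheis_antipode k0 lambda)). Qed.
Lemma uheis_antipode1 : antipode 1 = 1 :> U.
Proof. exact: (rmorph1 (uheis_antipode k0 lambda)). Qed.
Lemma heis_antipodeM (a b : H) : antipode (a * b) = antipode b * antipode a.
Proof. exact: (rmorphM (heis_antipode k0 lambda)). Qed.
Lemma heis_antipode1 : antipode 1 = 1 :> H.
Proof. exact: (rmorph1 (heis_antipode k0 lambda)). Qed.
Lemma antipode_ualphaV : antipode alphaV = alpha.
Proof.
exact: (plift_gen (P := uheis_presentation lambda) (@uheis_antipode_rel k k0 lambda) GenAinv).
Qed.
Lemma counit_ualphaV : counit alphaV = 1.
Proof.
exact: (plift_gen (P := uheis_presentation lambda) (@uheis_counit_rel k lambda) GenAinv).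
Qed.

#[local] Opaque uz ualpha ualphaV ubeta hX hY ht.

Let SD (x y : U) : antipode (x + y) = antipode x + antipode y.
Proof. exact: linearD. Qed.
Let SZ c (x : U) : antipode (c *: x) = c *: antipode x.
Proof. exact: linearZZ. Qed.
Let SHD (x y : H) : antipode (x + y) = antipode x + antipode y.
Proof. exact: linearD. Qed.
Let SHZ c (x : H) : antipode (c *: x) = c *: antipode x.
Proof. exact: linearZZ. Qed.
Let eD (x y : U) : counit (x + y) = counit x + counit y :> k.
Proof. exact: linearD. Qed.
Let eN (x : U) : counit (- x) = - counit x :> k.
Proof. exact: linearN. Qed.
Let eZ c (x : U) : counit (c *: x) = c * counit x :> k.
Proof. have := linearZZ (uheis_counit k0 lambda) c x; exact. Qed.
Let eM (x y : U) : counit (x * y) = counit x * counit y :> k.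
Proof. exact: rmorphM. Qed.
Let dD (x y : U) : comul (x + y) = comul x + comul y.
Proof. exact: linearD. Qed.
Let dN (x : U) : comul (- x) = - comul x.
Proof. exact: linearN. Qed.
Let dZ c (x : U) : comul (c *: x) = c *: comul x.
Proof. exact: linearZZ. Qed.
Let dM (x y : U) : comul (x * y) = comul x * comul y.
Proof. exact: rmorphM. Qed.
Let d1 : comul (1 : U) = 1 ⊗ 1.
Proof. exact: rmorph1. Qed.

Lemma uheis_counit_antipode (x : U) : counit (antipode x) = counit x.
Proof.
elim/presented_ind: x => [c|g|x y IHx IHy|x y IHx IHy].
- by rewrite SZ uheis_antipode1.
- case: g.
  + by rewrite -/z antipode_uz eN eM counit_uz mulr0 oppr0.
  + by rewrite -/alpha antipode_ualpha counit_ualpha counit_ualphaV.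
  + by rewrite -/alphaV antipode_ualphaV counit_ualpha counit_ualphaV.
  + by rewrite -/beta antipode_ubeta eN eM counit_ubeta mulr0 oppr0.
- by rewrite SD [LHS]eD IHx IHy [RHS]eD.
- by rewrite uheis_antipodeM [LHS]eM IHx IHy [RHS]eM mulrC.
Qed.

Let G := tflip (antipode : {linear U -> U}).

Let Gbal : balanced G.
Proof. exact: tflip_balanced. Qed.

Let GM u v : tlift G (u * v) = tlift G v * tlift G u.
Proof. exact: (tflipM uheis_antipodeM). Qed.

(** Both sides are linear and reverse products, so the generators decide. *)
Lemma uheis_comul_antipode (x : U) :
  comul (antipode x) = tlift (tflip antipode) (comul x).
Proof.
rewrite -/G; have tpureNl (a b : U) : (- a) ⊗ b = - (a ⊗ b) :> tensor U U.
  by rewrite -scaleN1r tpureZl scaleN1r.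
have tpureNr (a b : U) : a ⊗ (- b) = - (a ⊗ b) :> tensor U U.
  by rewrite -scaleN1r tpureZr scaleN1r.
elim/presented_ind: x => [c|g|x y IHx IHy|x y IHx IHy].
- rewrite SZ uheis_antipode1 !dZ !d1 -tpureZl tliftE // /G /tflip SZ uheis_antipode1.
  by rewrite tpureZr tpureZl.
- case: g.
  + rewrite -/z antipode_uz dN dM comul_ualphaV comul_uz mulrDr !tpureM.
    rewrite tliftD // !tliftE // /G /tflip antipode_uz antipode_ualpha uheis_antipode1.
    by rewrite ualphaVK mulr1 tpureNl tpureNr opprD addrC.
  + rewrite -/alpha antipode_ualpha comul_ualphaV comul_ualpha.
    by rewrite tliftE // /G /tflip antipode_ualpha.
  + rewrite -/alphaV antipode_ualphaV comul_ualphaV comul_ualpha.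
    by rewrite tliftE // /G /tflip antipode_ualphaV.
  + rewrite -/beta antipode_ubeta dN dM comul_ualphaV comul_ubeta mulrDr !tpureM.
    rewrite tliftD // !tliftE // /G /tflip antipode_ubeta antipode_ualpha uheis_antipode1.
    by rewrite ualphaVK mulr1 tpureNl tpureNr opprD addrC.
- by rewrite SD [LHS]dD IHx IHy [in RHS]dD tliftD.
- by rewrite uheis_antipodeM [LHS]dM IHx IHy [in RHS]dM GM.
Qed.

Let pDl a b x : p (a + b) x = p a x + p b x.
Proof. by rewrite /heis_pairing heis_actD eD. Qed.
Let pZl c a x : p (c *: a) x = c * p a x.
Proof. by rewrite /heis_pairing heis_actZ eZ. Qed.
Let pNl a x : p (- a) x = - p a x.
Proof. by rewrite -scaleN1r pZl mulN1r. Qed.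
Let pDr a x y : p a (x + y) = p a x + p a y.
Proof. by rewrite /heis_pairing heis_actDr eD. Qed.
Let pZr a c x : p a (c *: x) = c * p a x.
Proof. by rewrite /heis_pairing heis_actZr eZ. Qed.
Let pNr a x : p a (- x) = - p a x.
Proof. by rewrite -scaleN1r pZr mulN1r. Qed.
Let p1 a : p a 1 = counit a.
Proof. exact: heis_pairing_1r. Qed.

Let pYM x y : p Y (x * y) = p Y x * counit y + counit x * p Y y.
Proof. by rewrite /heis_pairing !heis_actY heis_act_YM eD !eM. Qed.
Let ptM x y : p t (x * y) = p t x * counit y + counit x * p t y.
Proof. by rewrite /heis_pairing !heis_actt heis_act_tM eD !eM. Qed.
Let pXM x y :
  p X (x * y) = p X x * counit y + counit x * p X y + p Y x * p t y.
Proof. by rewrite /heis_pairing !heis_actX !heis_actY !heis_actt heis_act_XM !eD !eM. Qed.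
(** The antipode of [X] contains [Y * t], so this functional is followed too; its rule is that of a
    composite of two derivations. *)
Let pYtM x y : p (Y * t) (x * y) =
  p (Y * t) x * counit y + counit x * p (Y * t) y + p t x * p Y y + p Y x * p t y.
Proof.
rewrite /heis_pairing !heis_actM !heis_actt !heis_actY heis_act_tM.
rewrite (linearD (heis_act_gen k0 lambda GenY)) !heis_act_YM !eD !eM.
ring.
Qed.

Let Yz : p Y z = 0. Proof. by rewrite /heis_pairing (values_on_gens GenY GenZ) /heis_act_table linear0. Qed.
Let Ya : p Y alpha = lambda.
Proof. by rewrite /heis_pairing (values_on_gens GenY GenA) /heis_act_table eZ counit_ualpha mulr1. Qed.
Let YaV : p Y alphaV = - lambda.
Proof. by rewrite /heis_pairing (values_on_gens GenY GenAinv) /heis_act_table eZ counit_ualphaV mulr1. Qed.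
Let Yb : p Y beta = 0. Proof. by rewrite /heis_pairing (values_on_gens GenY GenB) /heis_act_table linear0. Qed.
Let Tz : p t z = 1.
Proof. by rewrite /heis_pairing (values_on_gens GenT GenZ) /heis_act_table counit_ualpha. Qed.
Let Ta : p t alpha = 0. Proof. by rewrite /heis_pairing (values_on_gens GenT GenA) /heis_act_table linear0. Qed.
Let TaV : p t alphaV = 0. Proof. by rewrite /heis_pairing (values_on_gens GenT GenAinv) /heis_act_table linear0. Qed.
Let Tb : p t beta = 0. Proof. by rewrite /heis_pairing (values_on_gens GenT GenB) /heis_act_table linear0. Qed.
Let Xz : p X z = 0. Proof. by rewrite /heis_pairing (values_on_gens GenX GenZ) /heis_act_table linear0. Qed.
Let Xa : p X alpha = 0. Proof. by rewrite /heis_pairing (values_on_gens GenX GenA) /heis_act_table linear0. Qed.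
Let XaV : p X alphaV = 0. Proof. by rewrite /heis_pairing (values_on_gens GenX GenAinv) /heis_act_table linear0. Qed.
Let Xb : p X beta = 1.
Proof. by rewrite /heis_pairing (values_on_gens GenX GenB) /heis_act_table counit_ualpha. Qed.
Let YTz : p (Y * t) z = lambda.
Proof. by rewrite /heis_pairing heis_actM (values_on_gens GenT GenZ) /heis_act_table -/(heis_pairing _ _) Ya. Qed.
Let YTa : p (Y * t) alpha = 0.
Proof. by rewrite /heis_pairing heis_actM (values_on_gens GenT GenA) /heis_act_table !linear0. Qed.
Let YTaV : p (Y * t) alphaV = 0.
Proof. by rewrite /heis_pairing heis_actM (values_on_gens GenT GenAinv) /heis_act_table !linear0. Qed.
Let YTb : p (Y * t) beta = 0.
Proof. by rewrite /heis_pairing heis_actM (values_on_gens GenT GenB) /heis_act_table !linear0. Qed.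

Local Notation values := (Yz, Ya, YaV, Yb, Tz, Ta, TaV, Tb, Xz, Xa, XaV, Xb,
  YTz, YTa, YTaV, YTb, counit_uz k0 lambda, counit_ualpha k0 lambda,
  counit_ualphaV, counit_ubeta k0 lambda).
Local Notation simp := (mulr0, mul0r, mulr1, mul1r, addr0, add0r, oppr0, opprK).

Let SYE x : p Y (antipode x) = - p Y x.
Proof.
elim/presented_ind: x => [c|g|x y IHx IHy|x y IHx IHy].
- by rewrite SZ uheis_antipode1 !pZr p1 counit_hY !simp.
- case: g; rewrite -/z -/alpha -/alphaV -/beta.
  + by rewrite antipode_uz pNr pYM !values !simp.
  + by rewrite antipode_ualpha !values.
  + by rewrite antipode_ualphaV !values !simp.
  + by rewrite antipode_ubeta pNr pYM !values !simp.
- by rewrite SD !pDr IHx IHy opprD.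
- by rewrite uheis_antipodeM !pYM IHx IHy !uheis_counit_antipode; ring.
Qed.

Let STE x : p t (antipode x) = - p t x.
Proof.
elim/presented_ind: x => [c|g|x y IHx IHy|x y IHx IHy].
- by rewrite SZ uheis_antipode1 !pZr p1 counit_ht !simp.
- case: g; rewrite -/z -/alpha -/alphaV -/beta.
  + by rewrite antipode_uz pNr ptM !values !simp.
  + by rewrite antipode_ualpha !values !simp.
  + by rewrite antipode_ualphaV !values !simp.
  + by rewrite antipode_ubeta pNr ptM !values !simp.
- by rewrite SD !pDr IHx IHy opprD.
- by rewrite uheis_antipodeM !ptM IHx IHy !uheis_counit_antipode; ring.
Qed.

(** Reversal of the product turns the mixed term of [pXM] into [p Y y * p t x]. On the right, [pYtM]
    supplies both mixed terms, and one of them cancels against the mixed term of [- p X]. *)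
Let SXE x : p X (antipode x) = - p X x + p (Y * t) x.
Proof.
elim/presented_ind: x => [c|g|x y IHx IHy|x y IHx IHy].
- rewrite SZ uheis_antipode1 !pZr !p1 counit_hX !simp.
  by rewrite /heis_pairing rmorphM /= counit_hY !simp.
- case: g; rewrite -/z -/alpha -/alphaV -/beta.
  + by rewrite antipode_uz pNr pXM !values !simp.
  + by rewrite antipode_ualpha !values !simp.
  + by rewrite antipode_ualphaV !values !simp.
  + by rewrite antipode_ubeta pNr pXM !values !simp.
- by rewrite SD !pDr IHx IHy opprD addrACA.
- by rewrite uheis_antipodeM !pXM pYtM IHx IHy !uheis_counit_antipode SYE STE; ring.
Qed.

Lemma heis_pairing_antipode a x : p (antipode a) x = p a (antipode x).
Proof.
elim/presented_ind: a x => [c|g|a b IHa IHb|a b IHa IHb] x.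
- by rewrite SHZ heis_antipode1 !pZl !heis_pairing_1l uheis_counit_antipode.
- case: g; rewrite -/X -/Y -/t.
  + by rewrite antipode_hX SXE pDl pNl.
  + by rewrite antipode_hY SYE pNl.
  + by rewrite antipode_ht STE pNl.
- by rewrite SHD !pDl IHa IHb.
(* Reversing the product [a * b] matches flipping the legs of the coproduct of [antipode x]. *)
- rewrite heis_antipodeM !heis_pairing_mull uheis_comul_antipode.
  have bal u v : balanced (fun x1 x2 => p u x1 * p v x2).
    split=> [y y1 y2|y y1 y2|c y1 y2]; rewrite ?pDr ?mulrDl ?mulrDr //.
    by rewrite !pZr mulrCA mulrA.
  elim/tensor_ind: (comul x) => [|y1 y2|u v IHu IHv].
  + by rewrite (tlift0 (tflip_balanced _)) !(tlift0 (bal _ _)).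
  + by rewrite (tliftE (tflip_balanced _)) !(tliftE (bal _ _)) IHa IHb mulrC.
  + by rewrite (tliftD (tflip_balanced _)) !(tliftD (bal _ _)) IHu IHv.
Qed.

End HeisPairingAntipode.

(** * Values of the pairing on ordered monomials *)

Section HeisPairingValues.
#[local] Opaque pgen.
Variables (k : fieldType) (k0 : [pchar k] =i pred0) (lambda : k).
Local Notation U := (Uheis k0 lambda).
Local Notation z := (uz k0 lambda).
Local Notation alpha := (ualpha k0 lambda).
Local Notation alphaV := (ualphaV k0 lambda).
Local Notation beta := (ubeta k0 lambda).
Local Notation X := (hX k0 lambda).
Local Notation Y := (hY k0 lambda).
Local Notation t := (ht k0 lambda).
Local Notation act := (@heis_act k k0 lambda).
Local Notation p := (@heis_pairing k k0 lambda).
Local Notation alphaq := (@ualpha_exp k k0 lambda).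
Local Notation values_on_gens := (@heis_act_gen_pgen k k0 lambda).

Definition umon (m : nat) (q : int) (r : nat) : U := z ^+ m * alphaq q * beta ^+ r.

Lemma ualpha_beta : GRing.comm alpha beta.
Proof. exact/subr0_eq/ualphabeta. Qed.

Lemma ualpha_exp_succ q : alphaq (q + 1) = alphaq q * alpha.
Proof.
case: q => [n|[|n]].
- by rewrite -PoszD addn1 /= exprSr.
- by rewrite /= expr1 ualphaVK.
- have -> : Negz n.+1 + 1 = Negz n by rewrite !NegzE -addn1 PoszD opprD addrNK.
  by rewrite /= [in RHS]exprSr -mulrA ualphaVK mulr1.
Qed.

Lemma ualpha_exp_pred q : alphaq (q - 1) = alphaq q * alphaV.
Proof.
by rewrite -{2}[q](subrK 1) ualpha_exp_succ -mulrA ualphaK mulr1.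
Qed.

(** [ualpha_exp] splits on the sign of the exponent; this induction hides the split and adds one
    factor [alpha] or [alphaV] at a time, with [q] an arbitrary integer. *)
Lemma ualpha_exp_ind (Q : int -> U -> Prop) : Q 0 1 ->
  (forall q x, Q q x -> Q (q + 1) (x * alpha)) ->
  (forall q x, Q q x -> Q (q - 1) (x * alphaV)) ->
  forall q, Q q (alphaq q).
Proof.
move=> Q0 QS QP; elim/int_ind => [|n IHn|n IHn]; first exact: Q0.
  by rewrite -addn1 PoszD ualpha_exp_succ; exact: QS.
by rewrite -addn1 PoszD opprD ualpha_exp_pred; exact: QP.
Qed.

Let YM x y : act Y (x * y) = act Y x * y + x * act Y y.
Proof. by rewrite !heis_actY heis_act_YM. Qed.
Let TM x y : act t (x * y) = act t x * y + x * act t y.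
Proof. by rewrite !heis_actt heis_act_tM. Qed.
Let XM x y : act X (x * y) = act X x * y + x * act X y + act Y x * act t y.
Proof. by rewrite !heis_actX !heis_actY !heis_actt heis_act_XM. Qed.

Let Yz : act Y z = 0. Proof. exact: (values_on_gens GenY GenZ). Qed.
Let Ya : act Y alpha = lambda *: alpha. Proof. exact: (values_on_gens GenY GenA). Qed.
Let YaV : act Y alphaV = - lambda *: alphaV. Proof. exact: (values_on_gens GenY GenAinv). Qed.
Let Yb : act Y beta = 0. Proof. exact: (values_on_gens GenY GenB). Qed.
Let Tz : act t z = alpha. Proof. exact: (values_on_gens GenT GenZ). Qed.
Let Ta : act t alpha = 0. Proof. exact: (values_on_gens GenT GenA). Qed.
Let TaV : act t alphaV = 0. Proof. exact: (values_on_gens GenT GenAinv). Qed.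
Let Tb : act t beta = 0. Proof. exact: (values_on_gens GenT GenB). Qed.
Let Xz : act X z = 0. Proof. exact: (values_on_gens GenX GenZ). Qed.
Let Xa : act X alpha = 0. Proof. exact: (values_on_gens GenX GenA). Qed.
Let XaV : act X alphaV = 0. Proof. exact: (values_on_gens GenX GenAinv). Qed.
Let Xb : act X beta = alpha. Proof. exact: (values_on_gens GenX GenB). Qed.
Let Y1 : act Y 1 = 0. Proof. by rewrite heis_act_1r counit_hY scale0r. Qed.
Let T1 : act t 1 = 0. Proof. by rewrite heis_act_1r counit_ht scale0r. Qed.
Let X1 : act X 1 = 0. Proof. by rewrite heis_act_1r counit_hX scale0r. Qed.

#[local] Opaque uz ualpha ualphaV ubeta hX hY ht.

Let Yzm m : act Y (z ^+ m) = 0.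
Proof.
by elim: m => [|m IHm]; rewrite ?expr0 // exprS YM Yz IHm mul0r mulr0 addr0.
Qed.
Let Ybr r : act Y (beta ^+ r) = 0.
Proof.
by elim: r => [|m IHm]; rewrite ?expr0 // exprS YM Yb IHm mul0r mulr0 addr0.
Qed.
Let Tbr r : act t (beta ^+ r) = 0.
Proof.
by elim: r => [|m IHm]; rewrite ?expr0 // exprS TM Tb IHm mul0r mulr0 addr0.
Qed.
Let Xzm m : act X (z ^+ m) = 0.
Proof.
elim: m => [|m IHm]; first by rewrite expr0.
by rewrite exprS XM Xz Yz IHm !mul0r mulr0 !addr0.
Qed.
Let Yaq q : act Y (alphaq q) = (lambda *~ q) *: alphaq q.
Proof.
elim/ualpha_exp_ind: (alphaq q) => [|{}q x IHx|{}q x IHx].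
- by rewrite Y1 mulr0z scale0r.
- by rewrite YM IHx Ya -scalerAl -scalerAr -scalerDl mulrzDr mulr1z.
- by rewrite YM IHx YaV -scalerAl -scalerAr -scalerDl mulrzBr mulr1z.
Qed.
Let Taq q : act t (alphaq q) = 0.
Proof.
elim/ualpha_exp_ind: (alphaq q) => [|{}q x IHx|{}q x IHx] //.
- by rewrite TM IHx Ta mul0r mulr0 addr0.
- by rewrite TM IHx TaV mul0r mulr0 addr0.
Qed.
Let Xaq q : act X (alphaq q) = 0.
Proof.
elim/ualpha_exp_ind: (alphaq q) => [|{}q x IHx|{}q x IHx] //.
- by rewrite XM IHx Xa Ta mul0r !mulr0 !addr0.
- by rewrite XM IHx XaV TaV mul0r !mulr0 !addr0.
Qed.
Let Xbr r : act X (beta ^+ r.+1) = r.+1%:R *: (alpha * beta ^+ r).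
Proof.
elim: r => [|r IHr]; first by rewrite expr1 expr0 Xb mulr1 scale1r.
rewrite exprS XM Xb Yb IHr mul0r addr0 -scalerAr mulrA -ualpha_beta -mulrA -exprS.
by rewrite -[X in X + _]scale1r -scalerDl -(natrD _ 1) add1n.
Qed.

Lemma heis_actY_umon m q r : act Y (umon m q r) = (lambda *~ q) *: umon m q r.
Proof.
by rewrite /umon !YM Yzm Ybr Yaq mul0r mulr0 add0r addr0 -scalerAr -scalerAl.
Qed.

Let X_zaq m q : act X (z ^+ m * alphaq q) = 0.
Proof. by rewrite XM Xzm Yzm Xaq !mul0r mulr0 !addr0. Qed.

(** [X] kills [z ^+ m * alphaq q] and [t] kills [beta ^+ r], so only [X] on [beta ^+ r] contributes.
    At [r = 0] the coefficient is zero and the truncated predecessor is harmless. *)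
Lemma heis_actX_umon m q r :
  act X (umon m q r) = r%:R *: umon m (q + 1) r.-1.
Proof.
rewrite /umon XM X_zaq Tbr mul0r mulr0 addr0 add0r.
case: r => [|r]; first by rewrite expr0 X1 mulr0 scale0r.
by rewrite Xbr ualpha_exp_succ -scalerAr !mulrA.
Qed.

Lemma heis_actYn_umon l m q r :
  act (Y ^+ l) (umon m q r) = (lambda *~ q) ^+ l *: umon m q r.
Proof.
elim: l => [|l IHl]; first by rewrite !expr0 heis_act1 scale1r.
by rewrite exprSr heis_actM heis_actY_umon heis_actZr IHl scalerA -exprS.
Qed.

(** For [j > r] the falling factorial vanishes, which makes the truncated [r - j] harmless. *)
Lemma heis_actXn_umon j m q r :
  act (X ^+ j) (umon m q r) = (r ^_ j)%:R *: umon m (q + j) (r - j).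
Proof.
elim: j => [|j IHj].
  by rewrite expr0 heis_act1 ffactn0 scale1r addr0 subn0.
rewrite exprS heis_actM IHj heis_actZr heis_actX_umon scalerA -natrM -ffactnSr.
by rewrite subnS -addrA -PoszD addn1.
Qed.

(** Iterated Leibniz rule with [t . z = alpha] and [t . alpha = 0]. As [alpha] and [z] do not
    commute, a recursion on the power of [z] is handier than a closed form for [t ^+ i] on
    [z ^+ m]. *)
Lemma heis_acttn_z i x :
  act (t ^+ i.+1) (z * x) = z * act (t ^+ i.+1) x + i.+1%:R *: (alpha * act (t ^+ i) x).
Proof.
elim: i => [|i IHi]; first by rewrite expr1 expr0 heis_act1 TM Tz scale1r addrC.
rewrite exprS heis_actM IHi heis_actDr heis_actZr !TM Tz Ta mul0r add0r.
rewrite -!heis_actM -!exprS [_ + z * _]addrC -addrA; congr (_ + _).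
by rewrite -[X in X + _]scale1r -scalerDl -(natrD _ 1) add1n.
Qed.

Lemma heis_acttn_zaq i m q r :
  act (t ^+ i) (umon m q r) = act (t ^+ i) (z ^+ m) * alphaq q * beta ^+ r.
Proof.
elim: i => [|i IHi]; first by rewrite expr0 !heis_act1.
by rewrite exprS !heis_actM IHi !TM Tbr Taq !mulr0 !addr0.
Qed.

Let eM (x y : U) : counit (x * y) = counit x * counit y :> k.
Proof. exact: rmorphM. Qed.
Let e1 : counit (1 : U) = 1 :> k.
Proof. exact: rmorph1. Qed.

Let e_alphaq q : counit (alphaq q) = 1 :> k.
Proof.
elim/ualpha_exp_ind: (alphaq q) => // [{}q x IHx|{}q x IHx].
- by rewrite eM IHx counit_ualpha mulr1.
- by rewrite eM IHx counit_ualphaV mulr1.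
Qed.

Let e_pow0 (x : U) n : counit x = 0 :> k -> counit (x ^+ n) = (n == 0)%:R :> k.
Proof. by case: n => [|n] x0; rewrite ?expr0 // exprS eM x0 mul0r. Qed.

(** The counit kills the summand that starts with [z] and sends [alpha] to 1, so raising both
    exponents by one multiplies the value by [i.+1]; this produces the factorial. *)
Lemma heis_pairing_t_z i m : p (t ^+ i) (z ^+ m) = i`!%:R * (i == m)%:R.
Proof.
have eD (x y : U) : counit (x + y) = counit x + counit y :> k by exact: linearD.
have eZ c (x : U) : counit (c *: x) = c * counit x :> k.
  by have := linearZZ (uheis_counit k0 lambda) c x; exact.
elim: i m => [|i IHi] [|m].
- by rewrite !expr0 heis_pairing_1l e1 mulr1.
- by rewrite expr0 heis_pairing_1l e_pow0 ?mulr0 // counit_uz.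
- rewrite expr0 exprSr /heis_pairing heis_actM T1 mulr0.
  by rewrite (linear0 (act (t ^+ i))) linear0.
- rewrite [z ^+ _]exprS /heis_pairing heis_acttn_z eD eZ !eM counit_uz counit_ualpha.
  rewrite mul0r add0r mul1r -/(heis_pairing _ _) IHi eqSS factS natrM; ring.
Qed.

Lemma heis_pairing_umon i j l m q r :
  p (t ^+ i * X ^+ j * Y ^+ l) (umon m q r) =
  (i`! * j`!)%:R * (lambda *~ q) ^+ l * (i == m)%:R * (j == r)%:R.
Proof.
have eZ c (x : U) : counit (c *: x) = c * counit x :> k.
  by have := linearZZ (uheis_counit k0 lambda) c x; exact.
rewrite /heis_pairing !heis_actM heis_actYn_umon !heis_actZr heis_actXn_umon.
rewrite heis_actZr heis_acttn_zaq !eZ !eM e_alphaq -/(heis_pairing _ _).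
rewrite heis_pairing_t_z e_pow0 ?counit_ubeta // subn_eq0 natrM.
(* The falling factorial vanishes for [r < j], the counit of [beta ^+ (r - j)] for [j < r], and
   [r = j] leaves the factorial of [j]. *)
have -> : (r ^_ j)%:R * (i`!%:R * (i == m)%:R * 1 * (r <= j)%N%:R) =
          i`!%:R * (i == m)%:R * (j`!%:R * (j == r)%:R) :> k.
  have [rj|jr|->] := ltngtP r j.
  - by rewrite ffact_small // mul0r !mulr0.
  - by rewrite !mulr0.
  - by rewrite ffactnn; ring.
ring.
Qed.

End HeisPairingValues.

(** * Regrouping of sums and separation of points in characteristic zero *)

Lemma sum_by_key (I : eqType) (V W : zmodType) (F : I -> V -> W) (s : seq (I * V)) :
  (forall i, {morph F i : v w / v + w}) ->
  (forall i, \sum_(x <- s | x.1 == i) x.2 = 0) -> \sum_(x <- s) F x.1 x.2 = 0.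
Proof.
move=> FD s0; have F0 i : F i 0 = 0 by apply: (addrI (F i 0)); rewrite -FD !addr0.
(* An index may occur several times in the list, so the sum is regrouped over the distinct indices;
   additivity of [F i] then gathers the values of a group, whose total is zero. *)
have -> : \sum_(x <- s) F x.1 x.2 =
          \sum_(i <- undup [seq x.1 | x <- s]) \sum_(x <- s | x.1 == i) F i x.2.
  rewrite (exchange_big_dep xpredT) //=; rewrite !big_seq; apply: eq_bigr => x xs.
  rewrite -big_filter (_ : filter _ _ = [:: x.1]) ?big_seq1 //.
  have xu : x.1 \in undup [seq x.1 | x <- s] by rewrite mem_undup map_f.
  rewrite -(filter_pred1_uniq (undup_uniq _) xu).
  by apply: eq_filter => i; rewrite /= eq_sym.
by apply: big1 => i _; rewrite -(big_morph (F i) (FD i) (F0 i)) s0 F0.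
Qed.

Section CharacteristicZero.
Variables (k : fieldType) (k0 : [pchar k] =i pred0) (lambda : k).
Hypothesis lambda_neq0 : lambda != 0.

Lemma natr_neq0 n : (n.+1%:R : k) != 0.
Proof. by rewrite ((pcharf0P _).1 k0). Qed.

Lemma fact_neq0 n : (n`!%:R : k) != 0.
Proof. by rewrite ((pcharf0P _).1 k0) -lt0n fact_gt0. Qed.

Lemma mulrz_inj : injective (fun q : int => lambda *~ q).
Proof.
have mulrz0 q : lambda *~ q = 0 -> q = 0.
  case: q => [[//|n]|n] /eqP; first by rewrite -pmulrn -mulr_natr mulf_eq0 (negPf lambda_neq0) (negPf (natr_neq0 n)).
  by rewrite NegzE mulrNz oppr_eq0 -pmulrn -mulr_natr mulf_eq0 (negPf lambda_neq0) (negPf (natr_neq0 n)).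
by move=> q q' /= qq'; apply/subr0_eq/mulrz0; rewrite mulrzBr qq' subrr.
Qed.

(** The multiples of [lambda] by 0, ..., [size P - 1] are distinct roots, more than a nonzero [P]
    can have. *)
Lemma poly_mulrz_eq0 (P : {poly k}) : (forall q : int, P.[lambda *~ q] = 0) -> P = 0.
Proof.
move=> P0; apply/eqP/negPn/negP => Pn0.
pose s := [seq lambda *~ Posz n | n <- iota 0 (size P)].
suff: (size s < size P)%N by rewrite size_map size_iota ltnn.
apply: max_poly_roots => //.
  by apply/allP => x /mapP[n _ ->]; apply/rootP.
rewrite map_inj_uniq ?iota_uniq // => m n mn.
by have [] := mulrz_inj mn.
Qed.

End CharacteristicZero.

(** * Ordered monomials span [kHeis] *)

Section HeisBasis.
#[local] Opaque pgen.
Variables (k : fieldType) (k0 : [pchar k] =i pred0) (lambda : k).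
Local Notation H := (kHeis k0 lambda).
Local Notation X := (hX k0 lambda).
Local Notation Y := (hY k0 lambda).
Local Notation t := (ht k0 lambda).

Let YX : Y * X = X * Y + lambda *: X.
Proof. by rewrite -hYX /lie addrC subrK. Qed.
Let Yt : Y * t = t * Y + lambda *: t.
Proof. by rewrite -hYt /lie addrC subrK. Qed.
Let Xt : X * t = t * X + (lambda / 2) *: (t * t).
Proof. by rewrite -hXt /lie addrC subrK. Qed.

#[local] Opaque hX hY ht.

Lemma heis_Y_Xn n : Y * X ^+ n = X ^+ n * Y + (n%:R * lambda) *: X ^+ n.
Proof.
elim: n => [|n IHn]; first by rewrite expr0 mulr1 mul1r mul0r scale0r addr0.
rewrite exprS mulrA YX mulrDl -mulrA IHn mulrDr -scalerAl -scalerAr !mulrA -addrA.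
by rewrite -scalerDl -[n.+1]addn1 natrD mulrDl mul1r.
Qed.

Lemma heis_Y_tn n : Y * t ^+ n = t ^+ n * Y + (n%:R * lambda) *: t ^+ n.
Proof.
elim: n => [|n IHn]; first by rewrite expr0 mulr1 mul1r mul0r scale0r addr0.
rewrite exprS mulrA Yt mulrDl -mulrA IHn mulrDr -scalerAl -scalerAr !mulrA -addrA.
by rewrite -scalerDl -[n.+1]addn1 natrD mulrDl mul1r.
Qed.

Lemma heis_X_tn n : X * t ^+ n = t ^+ n * X + (n%:R * (lambda / 2)) *: t ^+ n.+1.
Proof.
elim: n => [|n IHn]; first by rewrite expr0 mulr1 mul1r mul0r scale0r addr0.
rewrite exprS mulrA Xt mulrDl -mulrA IHn mulrDr -scalerAl -scalerAr -!mulrA -!exprS.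
by rewrite mulrA -exprS -addrA -scalerDl -[n.+1]addn1 natrD mulrDl mul1r.
Qed.

(** All powers of [Y] with the same [t] and [X] exponents are gathered in one polynomial, since the
    pairing sees them only through its values at the points [lambda *~ q]. *)
Definition hpbw (x : nat * nat * {poly k}) : H :=
  t ^+ x.1.1 * X ^+ x.1.2 * horner_alg Y x.2.

Definition heis_spanned (a : H) := exists s, a = \sum_(x <- s) hpbw x.

Lemma heis_spanned_hpbw x : heis_spanned (hpbw x).
Proof. by exists [:: x]; rewrite big_seq1. Qed.

Lemma heis_spannedD a b : heis_spanned a -> heis_spanned b -> heis_spanned (a + b).
Proof. by case=> s -> [s' ->]; exists (s ++ s'); rewrite big_cat. Qed.

Lemma heis_spannedMl a b : (forall x, heis_spanned (a * hpbw x)) ->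
  heis_spanned b -> heis_spanned (a * b).
Proof.
move=> ax [s ->]; rewrite mulr_sumr; elim: s => [|x s IHs].
  by rewrite big_nil; exists [::]; rewrite big_nil.
by rewrite big_cons; exact: heis_spannedD.
Qed.

Lemma hpbwZ c i j P : c *: hpbw (i, j, P) = hpbw (i, j, c *: P).
Proof. by rewrite /hpbw /= -[c *: P]mul_polyC rmorphM /= horner_algC mulr_algl scalerAr. Qed.

Lemma heis_spannedZ c b : heis_spanned b -> heis_spanned (c *: b).
Proof.
rewrite -[c *: b]mul1r -scalerAr scalerAl; apply: heis_spannedMl => -[[i j] P].
rewrite -scalerAl mul1r hpbwZ; exact: heis_spanned_hpbw.
Qed.

(** The span contains 1 and is stable under left multiplication by each generator, which is moved
    past the powers of [t] and [X] to its place. *)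
Lemma heis_pbw a : heis_spanned a.
Proof.
suff h b : heis_spanned b -> heis_spanned (a * b).
  have -> : a = a * hpbw (0%N, 0%N, 1) by rewrite /hpbw /= rmorph1 !mulr1.
  exact/h/heis_spanned_hpbw.
elim/presented_ind: a b => [c|g|x y IHx IHy|x y IHx IHy] b sb.
- by rewrite -scalerAl mul1r; exact: heis_spannedZ.
- apply: heis_spannedMl sb => -[[i j] P]; case: g; rewrite -/X -/Y -/t.
  + rewrite /hpbw /= !mulrA heis_X_tn !mulrDl -[_ * X * _]mulrA -exprS.
    apply: heis_spannedD; first exact: (heis_spanned_hpbw (i, j.+1, P)).
    rewrite -!scalerAl; apply: heis_spannedZ.
    exact: (heis_spanned_hpbw (i.+1, j, P)).
  + rewrite /hpbw /= !mulrA heis_Y_tn !mulrDl -[_ * Y * _]mulrA heis_Y_Xn.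
    rewrite mulrDr mulrDl; apply: heis_spannedD; last first.
      by rewrite -!scalerAl; apply: heis_spannedZ; exact: (heis_spanned_hpbw (i, j, P)).
    apply: heis_spannedD; last first.
      rewrite -!scalerAr -scalerAl; apply: heis_spannedZ.
      exact: (heis_spanned_hpbw (i, j, P)).
    (* Once [Y] has reached the polynomial factor it is absorbed by multiplying [P] with the
       indeterminate. *)
    rewrite mulrA -mulrA -[X in X * horner_alg _ _](horner_algX Y) -rmorphM.
    exact: (heis_spanned_hpbw (i, j, 'X * P)).
  + by rewrite /hpbw /= !mulrA -exprS; exact: (heis_spanned_hpbw (i.+1, j, P)).
- by rewrite mulrDl; apply: heis_spannedD; [exact: IHx|exact: IHy].
- by rewrite -mulrA; apply/IHx/IHy.
Qed.

End HeisBasis.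

(** * Ordered monomials span [Uheis] *)

Section UheisBasis.
#[local] Opaque pgen.
Variables (k : fieldType) (k0 : [pchar k] =i pred0) (lambda : k).
Local Notation U := (Uheis k0 lambda).
Local Notation z := (uz k0 lambda).
Local Notation alpha := (ualpha k0 lambda).
Local Notation alphaV := (ualphaV k0 lambda).
Local Notation beta := (ubeta k0 lambda).
Local Notation alphaq := (@ualpha_exp k k0 lambda).
Local Notation umon := (@umon k k0 lambda).

Let ab : alpha * beta = beta * alpha. Proof. exact: ualpha_beta. Qed.

Let aVb : alphaV * beta = beta * alphaV.
Proof.
rewrite -[LHS]mulr1 -(ualphaK k0 lambda) mulrA -(mulrA alphaV) -ab.
by rewrite (mulrA alphaV alpha) ualphaVK mul1r.
Qed.

Let az : alpha * z = z * alpha + lambda *: (alpha * beta).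
Proof.
have <- : lie alpha z = lambda *: (alpha * beta).
  by rewrite lie_anti uzalpha scaleNr opprK.
by rewrite /lie addrC subrK.
Qed.

Let bz : beta * z = z * beta + (lambda / 2) *: (beta * beta).
Proof.
have <- : lie beta z = (lambda / 2) *: (beta * beta).
  by rewrite lie_anti uzbeta scaleNr opprK.
by rewrite /lie addrC subrK.
Qed.

#[local] Opaque uz ualpha ualphaV ubeta.

Let aVz : alphaV * z = z * alphaV - lambda *: (alphaV * beta).
Proof.
have : alphaV * (alpha * z) * alphaV = alphaV * (z * alpha + lambda *: (alpha * beta)) * alphaV.
  by rewrite az.
rewrite mulrA ualphaVK mul1r mulrDr mulrDl -scalerAr -scalerAl => ->.
rewrite -!mulrA ualphaK mulr1 [alphaV * (alpha * _)]mulrA ualphaVK mul1r -aVb.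
by rewrite addrK.
Qed.

Lemma uheis_betan_z n :
  beta ^+ n * z = z * beta ^+ n + (n%:R * (lambda / 2)) *: beta ^+ n.+1.
Proof.
elim: n => [|n IHn]; first by rewrite expr0 mulr1 mul1r mul0r scale0r addr0.
rewrite exprSr -mulrA bz mulrDr mulrA IHn mulrDl -scalerAl -scalerAr !mulrA.
rewrite -!exprSr -mulrA -exprSr -addrA -scalerDl.
have -> : n.+1%:R = n%:R + 1 :> k by rewrite -addn1 natrD.
by rewrite !mulrDl mul1r.
Qed.

Lemma uheis_alphaq_z q :
  alphaq q * z = z * alphaq q + (lambda *~ q) *: (alphaq q * beta).
Proof.
elim/ualpha_exp_ind: (alphaq q) => [|{}q x IHx|{}q x IHx].
- by rewrite mulr1 mul1r mulr0z scale0r addr0.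
- rewrite -mulrA az mulrDr !mulrA IHx mulrDl -scalerAl -!mulrA -ab -scalerAr.
  by rewrite -addrA -scalerDl mulrzDr mulr1z.
- rewrite -mulrA aVz mulrBr !mulrA IHx mulrDl -scalerAl -!mulrA -aVb -scalerAr.
  by rewrite -addrA -scalerBl mulrzBr mulr1z.
Qed.

Lemma umon_alpha m q r : umon m q r * alpha = umon m (q + 1) r.
Proof.
by rewrite /umon ualpha_exp_succ -mulrA -(commrX r (ab : GRing.comm alpha beta)) !mulrA.
Qed.

Lemma umon_alphaV m q r : umon m q r * alphaV = umon m (q - 1) r.
Proof.
by rewrite /umon ualpha_exp_pred -mulrA -(commrX r (aVb : GRing.comm alphaV beta)) !mulrA.
Qed.

Lemma umon_beta m q r : umon m q r * beta = umon m q r.+1.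
Proof. by rewrite /umon -mulrA -exprSr. Qed.

Lemma umon_z m q r : umon m q r * z =
  umon m.+1 q r + (lambda *~ q + r%:R * (lambda / 2)) *: umon m q r.+1.
Proof.
rewrite /umon -mulrA uheis_betan_z mulrDr mulrA -[_ * _ * z]mulrA uheis_alphaq_z.
rewrite mulrDr mulrDl mulrA -exprSr -!scalerAr -scalerAl scalerDl addrA.
by rewrite [beta ^+ r.+1]exprS !mulrA.
Qed.

Definition uheis_spanned (x : U) := exists s : seq (nat * int * nat * k),
  x = \sum_(y <- s) y.2 *: umon y.1.1.1 y.1.1.2 y.1.2.

Lemma uheis_spanned_umon m q r : uheis_spanned (umon m q r).
Proof. by exists [:: (m, q, r, 1)]; rewrite big_seq1 scale1r. Qed.

Lemma uheis_spannedD x y : uheis_spanned x -> uheis_spanned y -> uheis_spanned (x + y).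
Proof. by case=> s -> [s' ->]; exists (s ++ s'); rewrite big_cat. Qed.

Lemma uheis_spannedZ c x : uheis_spanned x -> uheis_spanned (c *: x).
Proof.
case=> s ->; exists [seq (y.1, c * y.2) | y <- s].
by rewrite big_map scaler_sumr; apply: eq_bigr => y _; rewrite scalerA.
Qed.

Lemma uheis_spannedMr x y : (forall m q r, uheis_spanned (umon m q r * y)) ->
  uheis_spanned x -> uheis_spanned (x * y).
Proof.
move=> ay [s ->]; rewrite mulr_suml; elim: s => [|c s IHs].
  by rewrite big_nil; exists [::]; rewrite big_nil.
rewrite big_cons -scalerAl; apply: uheis_spannedD => //.
exact/uheis_spannedZ/ay.
Qed.

(** The span contains 1 and is stable under right multiplication by the generators. On this side
    [alpha], its inverse and [beta] only shift an exponent, and [z] leaves a single correction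
    term. *)
Lemma uheis_pbw x : uheis_spanned x.
Proof.
suff h y : uheis_spanned y -> uheis_spanned (y * x).
  have -> : x = umon 0 0 0 * x by rewrite /umon !mulr1 mul1r.
  exact/h/uheis_spanned_umon.
elim/presented_ind: x y => [c|g|x y IHx IHy|x y IHx IHy] u su.
- by rewrite -scalerAr mulr1; exact: uheis_spannedZ.
- apply: uheis_spannedMr su => m q r; case: g; rewrite -/z -/alpha -/alphaV -/beta.
  + rewrite umon_z; apply: uheis_spannedD; first exact: uheis_spanned_umon.
    exact/uheis_spannedZ/uheis_spanned_umon.
  + by rewrite umon_alpha; exact: uheis_spanned_umon.
  + by rewrite umon_alphaV; exact: uheis_spanned_umon.
  + by rewrite umon_beta; exact: uheis_spanned_umon.
- by rewrite mulrDr; apply: uheis_spannedD; [exact: IHx|exact: IHy].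
- by rewrite mulrA; apply/IHy/IHx.
Qed.

End UheisBasis.

(** * Nondegeneracy on both sides *)

Section Nondegeneracy.
#[local] Opaque pgen.
Variables (k : fieldType) (k0 : [pchar k] =i pred0) (lambda : k).
Hypothesis lambda_neq0 : lambda != 0.
Local Notation Y := (hY k0 lambda).
Local Notation p := (@heis_pairing k k0 lambda).
Local Notation hpbw := (@hpbw k k0 lambda).
Local Notation umon := (@umon k k0 lambda).

Let pZr a c x : p a (c *: x) = c * p a x. Proof. exact: (linearZr_LR p). Qed.

(** Monomials are eigenvectors of [Y] with eigenvalue [lambda *~ q], so a polynomial in [Y] acts by
    its value there. *)
Lemma heis_act_horner_alg P m q r :
  heis_act (horner_alg Y P) (umon m q r) = P.[lambda *~ q] *: umon m q r.
Proof.
elim/poly_ind: P => [|P c IHP].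
  by rewrite rmorph0 -(scale0r 0) heis_actZ horner0 !scale0r.
rewrite rmorphD rmorphM /= horner_algX horner_algC heis_actD heis_actM heis_actZ.
rewrite heis_act1 heis_actY_umon heis_actZr IHP !hornerE scalerA -scalerDl.
by rewrite mulrC.
Qed.

Lemma heis_pairing_hpbw x m q r :
  p (hpbw x) (umon m q r) =
  (x.1 == (m, r))%:R * ((m`! * r`!)%:R * x.2.[lambda *~ q]).
Proof.
case: x => [[i j] P]; rewrite /hpbw /heis_pairing heis_actM heis_act_horner_alg.
rewrite -/(heis_pairing _ _) pZr.
have := heis_pairing_umon k0 lambda i j 0 m q r; rewrite expr0 !mulr1 => ->.
rewrite /= xpair_eqE; have [->|_] := eqVneq i m; have [->|_] := eqVneq j r;
  by rewrite /=; ring.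
Qed.

(** Pairing with the monomial of exponents [m], [q], [r] isolates the total polynomial at index
    [(m, r)], evaluated at [lambda *~ q] and scaled by nonzero factorials. Letting [q] vary forces
    this polynomial to be zero. *)
Lemma heis_pairing_nondegenerate_l a : (forall x, p a x = 0) -> a = 0.
Proof.
have [s ->] := heis_pbw a => a0.
apply: (sum_by_key (F := fun ij P => hpbw (ij, P))) => [ij P Q|[m r]].
  by rewrite /hpbw rmorphD mulrDr.
apply: (poly_mulrz_eq0 k0 lambda_neq0) => q.
apply: (mulfI (fact_neq0 k0 m)); apply: (mulfI (fact_neq0 k0 r)).
rewrite !mulr0 -[RHS](a0 (umon m q r)) linear_sumlz horner_sum !mulr_sumr.
rewrite [LHS]big_mkcond; apply: eq_bigr => -[ij P] _.
rewrite [RHS](heis_pairing_hpbw (ij, P) m q r) natrM /=.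
by case: eqP => _ /=; ring.
Qed.

Lemma heis_pairing_nondegenerate_r x : (forall a, p a x = 0) -> x = 0.
Proof.
have [s ->] := uheis_pbw x => x0.
apply: (sum_by_key (F := fun i (c : k) => c *: umon i.1.1 i.1.2 i.2)).
  by move=> i c d; rewrite scalerDl.
move=> [[m q] r].
(* A Lagrange-type polynomial: it vanishes at the points of all other exponents of [alpha] in the
   list and not at that of [q]. Pairing with [t ^+ m * X ^+ r * P(Y)] therefore isolates the total
   coefficient at [(m, q, r)]. *)
pose P := \prod_(q' <- [seq y.1.1.2 | y <- s] | q' != q) ('X - (lambda *~ q')%:P).
have Pq : P.[lambda *~ q] != 0.
  rewrite horner_prod prodf_seq_neq0; apply/allP => q' _ /=; apply/implyP => q'q.
  rewrite hornerXsubC subr_eq0; apply: contra_neq q'q => e.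
  by have := mulrz_inj k0 lambda_neq0 e.
have Pq' y : y \in s -> y.1.1.2 != q -> P.[lambda *~ y.1.1.2] = 0.
  move=> ys yq; apply/eqP; rewrite horner_prod prodf_seq_eq0; apply/hasP.
  by exists y.1.1.2; [exact: map_f|rewrite yq hornerXsubC subrr eqxx].
apply: (mulfI Pq); apply: (mulfI (fact_neq0 k0 m)); apply: (mulfI (fact_neq0 k0 r)).
rewrite !mulr0 -[RHS](x0 (hpbw (m, r, P))) linear_sumr !mulr_sumr.
rewrite [LHS]big_mkcond !big_seq; apply: eq_bigr => -[[[m' q'] r'] c] ys.
rewrite [RHS](pZr _ c) (heis_pairing_hpbw (m, r, P) m' q' r') /= !xpair_eqE.
have [->|_] := eqVneq m' m; last by rewrite mul0r mulr0.
have [e|/(Pq' _ ys) /= ->] := eqVneq q' q; last by rewrite !mulr0.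
have [->|_] := eqVneq r' r; last by rewrite mul0r mulr0.
by rewrite e natrM /=; ring.
Qed.

End Nondegeneracy.

Theorem lemma4p8 (k : fieldType) (k0 : [pchar k] =i pred0)
    (lambda : k) (lambda_neq0 : lambda != 0) :
  exists p : {bilinear kHeis k0 lambda -> Uheis k0 lambda -> k | *%R & *%R},
    [/\ hopf_pairing p,
        nondegenerate_pairing p &
        forall (i j l m r : nat) (q : int),
          p (ht k0 lambda ^+ i * hX k0 lambda ^+ j * hY k0 lambda ^+ l)
            (uz k0 lambda ^+ m * ualpha_exp k0 lambda q * ubeta k0 lambda ^+ r)
          = (i`! * j`!)%:R * (lambda *~ q) ^+ l * (i == m)%:R * (j == r)%:R].
Proof.
exists (@heis_pairing k k0 lambda); split.
- split.
  + exact: heis_pairing_mulr.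
  + exact: heis_pairing_mull.
  + exact: heis_pairing_antipode.
  + exact: heis_pairing_1r.
  + exact: heis_pairing_1l.
- split; first exact: heis_pairing_nondegenerate_l.
  exact: heis_pairing_nondegenerate_r.
- by move=> *; exact: heis_pairing_umon.
Qed.
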